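(* Let $B_1\subseteq\mathbb{R}^{n+1}$ be the unit ball with boundary the unit sphere $\mathbb{S}^n$, where $n=2k+1$ for some integer $k\geq 1$. For $\lambda>0$ let $\hat g^\lambda$ be the homogeneous metric on $\mathbb{S}^n\cong\mathrm{SU}(k+1)/\mathrm{SU}(k)$ which at a point has the standard diagonal form $\hat g^\lambda=\sigma_1^2+\lambda(\sigma_2^2+\cdots+\sigma_n^2)$. Then, as $\lambda$ varies continuously from $\lambda=1$ on the interval $(\frac{1}{n+1},1]$ (resp. on $[1,n+1)$), one of the following holds: (a) for each $\lambda\in(\frac{1}{n+1},1]$ (resp. $\lambda\in[1,n+1)$) there exists a non-positively curved conformally compact Einstein metric on $B_1$ with conformal infinity $(\mathbb{S}^n,[\hat g^\lambda])$; or (b) there exists $\lambda_1\in(\frac{1}{n+1},1]$ (resp. $\lambda_1\in[1,n+1)$) such that for each $\lambda\in[\lambda_1,1]$ (resp. $\lambda\in[1,\lambda_1]$) there exists a non-positively curved conformally compact Einstein metric $g^\lambda$ on $B_1$ with conformal infinity $(\mathbb{S}^n,[\hat g^\lambda])$, there exists $p\in B_1$ such that the sectional curvature of $g^{\lambda_1}$ at $p$ vanishes in some direction, and moreover for any small $\epsilon>0$ there exists $\lambda_2\in(\lambda_1-\epsilon,\lambda_1)$ (resp. $\lambda_2\in(\lambda_1,\lambda_1+\epsilon)$) and a conformally compact Einstein metric $g^{\lambda_2}$ on $B_1$ with conformal infinity $(\mathbb{S}^n,[\hat g^{\lambda_2}])$ whose sectional curvature is positive in some direction at some point of $B_1$.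
   Context: $\sigma_1,\dots,\sigma_n$ are the $1$-forms dual to a basis of $\mathfrak p$ in the $\mathrm{Ad}_{\mathrm{SU}(k)}$-invariant splitting $\mathfrak{su}(k+1)=\mathfrak{su}(k)\oplus\mathfrak p$, where $\mathfrak p=\mathfrak p_0\oplus\mathfrak p_1$ with $\mathfrak p_0$ one-dimensional with trivial $\mathrm{SU}(k)$-action (dual to $\sigma_1$) and $\mathfrak p_1$ the irreducible complement (dual to $\sigma_2,\dots,\sigma_n$); normalized so that $\hat g^1$ is the round metric. A complete metric $g$ on $B_1$ is conformally compact if for some defining function $x$ ($x>0$ in $B_1$, $x=0$ and $dx\ne0$ on $\mathbb{S}^n$) $x^2g$ extends continuously to $\overline{B_1}$; its conformal infinity is the conformal class of $x^2g|_{\mathbb{S}^n}$; it is conformally compact Einstein if in addition $\mathrm{Ric}_g=-ng$. *)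

(* Defs.v *)
(* Everything is done in the single global
   chart B_1 of R^(n+1); points are row vectors 'rV[R]_(n.+1). *)
From HB Require Import structures.
From mathcomp Require Import all_boot all_order all_algebra.
From mathcomp Require Import all_classical all_reals all_analysis.
Set Implicit Arguments. Unset Strict Implicit. Unset Printing Implicit Defensive.
Import Order.TTheory GRing.Theory Num.Theory.
Import numFieldNormedType.Exports.
Local Open Scope classical_set_scope.
Local Open Scope ring_scope.

Section Defs.
Variable R : realType.
Variable n : nat.
Local Notation N := n.+1.
Local Notation pt := 'rV[R]_N.
Local Notation mx := 'M[R]_N.

Definition edot (u v : pt) : R := \sum_(i < N) u 0 i * v 0 i.
Definition ball1 : set pt := [set p | edot p p < 1].
Definition sphere1 : set pt := [set p | edot p p = 1].
Definition cball1 : set pt := [set p | edot p p <= 1].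

Definition ecoord (i : 'I_N) : pt := delta_mx 0 i.
Definition pd (i : 'I_N) (f : pt -> R) : pt -> R := fun x => 'D_(ecoord i) f x.
Definition iterpd (l : seq 'I_N) (f : pt -> R) : pt -> R := foldr pd f l.

Definition smooth_on (U : set pt) (f : pt -> R) : Prop :=
  forall (l : seq 'I_N) (x : pt), U x ->
    {for x, continuous (iterpd l f)} /\ forall i, derivable (iterpd l f) x (ecoord i).

Definition bil (A : mx) (u v : pt) : R := (u *m A *m v^T) 0 0.

Definition riem_metric (U : set pt) (g : pt -> mx) : Prop :=
  (forall i j, smooth_on U (fun x => g x i j)) /\
  (forall x, U x -> (g x)^T = g x /\ forall v : pt, v != 0 -> 0 < bil (g x) v v).

Definition christ (g : pt -> mx) (l i j : 'I_N) (x : pt) : R :=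
  2^-1 * \sum_(m < N) (invmx (g x)) l m *
     (pd i (fun y => g y j m) x + pd j (fun y => g y i m) x
      - pd m (fun y => g y i j) x).

(* riem g i j k l x = R^l_{ijk}, where R(d_i,d_j)d_k = sum_l R^l_{ijk} d_l
   and R(X,Y) = nabla_X nabla_Y - nabla_Y nabla_X - nabla_[X,Y] *)
Definition riem (g : pt -> mx) (i j k l : 'I_N) (x : pt) : R :=
  pd i (christ g l j k) x - pd j (christ g l i k) x
  + \sum_(m < N) (christ g l i m x * christ g m j k x
                  - christ g l j m x * christ g m i k x).

Definition ricci (g : pt -> mx) (j k : 'I_N) (x : pt) : R :=
  \sum_(i < N) riem g i j k i x.

Definition sec (g : pt -> mx) (x X Y : pt) : R :=
  (\sum_(i < N) \sum_(j < N) \sum_(k < N) \sum_(l < N) \sum_(m < N)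
     X 0 i * Y 0 j * Y 0 k * riem g i j k l x * g x l m * X 0 m)
  / (bil (g x) X X * bil (g x) Y Y - bil (g x) X Y ^+ 2).

Definition indep2 (X Y : pt) : Prop := \rank (col_mx X Y) = 2%N.

Definition einstein_ball (g : pt -> mx) : Prop :=
  forall x, ball1 x -> forall j k, ricci g j k x = - n%:R * g x j k.

Definition C1curve (c : R -> pt) : Prop :=
  (forall t, 0 <= t <= 1 -> derivable c t 1) /\
  {within `[0, 1]%classic, continuous (derive1 c)}.

Definition glength (g : pt -> mx) (c : R -> pt) : R :=
  Rintegral lebesgue_measure `[0, 1]%classic
    (fun t => Num.sqrt (bil (g (c t)) (derive1 c t) (derive1 c t))).

Definition gdist (g : pt -> mx) (p q : pt) : R :=
  inf [set L | exists c : R -> pt,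
         [/\ C1curve c, (forall t, 0 <= t <= 1 -> ball1 (c t)),
             c 0 = p, c 1 = q & L = glength g c]].

Definition complete_ball (g : pt -> mx) : Prop :=
  forall u : nat -> pt, (forall m, ball1 (u m)) ->
    (forall e, 0 < e -> exists M, forall a b, (M <= a)%N -> (M <= b)%N ->
        gdist g (u a) (u b) < e) ->
    exists2 p, ball1 p & u @ \oo --> p.

Definition defining_fn (x : pt -> R) : Prop :=
  (forall p, ball1 p -> 0 < x p) /\
  (forall p, cball1 p -> differentiable x p) /\
  (forall p, sphere1 p -> x p = 0 /\ exists v : pt, 'd x p v != 0).

(* The Hopf (Reeb) vector field J p on S^n, n = 2k+1, in C^{k+1} = R^{2k+2}
   (coordinates (2a, 2a+1) = (Re z_a, Im z_a)), p |-> i p. *)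
Definition Jrot (p : pt) : pt :=
  \row_(i < N) (if odd i then p 0 (inord i.-1) else - p 0 (inord i.+1)).

(* hat g^lambda = sigma_1^2 + lambda (sigma_2^2 + ... + sigma_n^2)
   = lambda * round + (1 - lambda) * eta^2, eta = <J p, .>, on T_p S^n *)
Definition berger (lam : R) (p u v : pt) : R :=
  lam * edot u v + (1 - lam) * (edot (Jrot p) u * edot (Jrot p) v).

Definition CCE_with_infinity (g : pt -> mx) (lam : R) : Prop :=
  [/\ riem_metric ball1 g, complete_ball g, einstein_ball g &
   exists (x : pt -> R) (gbar : pt -> mx) (phi : pt -> R),
     [/\ defining_fn x,
         {within cball1, continuous gbar},
         (forall p, ball1 p -> gbar p = (x p) ^+ 2 *: g p) &
         (forall p, sphere1 p -> 0 < phi p /\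
            forall u v : pt, edot u p = 0 -> edot v p = 0 ->
              bil (gbar p) u v = phi p * berger lam p u v)]].

Definition nonpos_curved (g : pt -> mx) : Prop :=
  forall p X Y, ball1 p -> indep2 X Y -> sec g p X Y <= 0.

Definition sec_vanishes_somewhere (g : pt -> mx) : Prop :=
  exists p X Y, [/\ ball1 p, indep2 X Y & sec g p X Y = 0].

Definition sec_positive_somewhere (g : pt -> mx) : Prop :=
  exists p X Y, [/\ ball1 p, indep2 X Y & 0 < sec g p X Y].

End Defs.

(* Main.v *)
(* Write J for the complex structure of C^(k+1) = R^(n+1), t = |x|^2, and
   let b be the polynomial solution of
     t (1 - t^2) b' + (k + 2 + 2 k t + k t^2) b = (2 k + 1) / 2.
   With d = 4 (1 - 1/lambda) b(t) and e = 1 - t d, the Taub-NUT-AdS metric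
     g = 4 / (lambda (1 - t)^2) (|dx|^2 + (d / e) <x, dx>^2 - d <Jx, dx>^2)
   is smooth on the ball, complete, conformally compact with the prescribed
   conformal infinity (as b(1) = 1/4), and for it Einstein's equation is
   precisely the above ODE for b.  So every lambda > 0 is filled explicitly.

   In a frame adapted to the radial and Hopf directions the curvature is affine
   in lambda: a sectional curvature is -1 + (lambda - 1) W, where W does not
   depend on lambda and -1 <= W <= 3k / (k + 2), the upper bound being attained
   at the center on complex lines.  Hence the curvature is nonpositive exactly
   when lambda <= 1 + (k + 2) / (3k): alternative (a) holds below 1, and
   alternative (b) above 1 with this value as lambda_1.  The bounds on W reduce
   to comparing b with explicit rational functions. *)

Require Import Defs.
From HB Require Import structures.
From mathcomp Require Import all_boot all_order all_algebra.
From mathcomp Require Import all_classical all_reals all_analysis.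
From mathcomp Require Import ring lra zify.
Import Order.TTheory GRing.Theory Num.Theory.
Import numFieldNormedType.Exports.
Local Open Scope classical_set_scope.
Local Open Scope ring_scope.

Set Implicit Arguments. Unset Strict Implicit. Unset Printing Implicit Defensive.

(** On the tangent space at [x] the bracket in the metric multiplies squared lengths by [1 / e]
    radially, by [e] along the Hopf direction, and by 1 elsewhere. As the two factors are
    reciprocal, raising an index is as simple as lowering one.

    Frames adapted to [x] and [Jx] degenerate at the center, so none is built. Every tensor is
    written through Euclidean pairings of [x], [Jx] and its arguments; index sums collapse by
    linearity, and each geometric fact becomes a rational identity in finitely many real unknowns.
    The center, where the ODE is singular, is treated apart.

    The obstacle is the bound on W over all planes: W is not diagonal, since it couples the
    radial-Hopf component of a plane to the Kaehler form of its horizontal part. A plane is spanned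
    by two vectors, so its bivector is decomposable, and this bounds the coupling by the mixed
    components. What remains is linear in [(1 - t)^2 b] and [t b], and the rational functions
    compared with b are read off from the inequalities required there. *)

(** * The polynomial solution of the singular ODE *)

Section Profile.
Context {R : realType}.
Implicit Types (k : nat) (t : R).

(* The coefficient [t * (1 - t ^+ 2)] vanishes at both endpoints, so no boundary
   condition is needed to exclude a negative minimum there. *)
Lemma singular_max_principle (D D' r : R -> R) :
  (forall t, 0 <= t <= 1 -> is_derive t 1 D (D' t)) ->
  (forall t, 0 <= t <= 1 -> 0 < r t) ->
  (forall t, 0 <= t <= 1 -> 0 <= t * (1 - t ^+ 2) * D' t + r t * D t) ->
  forall t, 0 <= t <= 1 -> 0 <= D t.
Proof.
move=> dD r0 H t t01.
have cD : {within `[0, 1], continuous D}.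
  apply: derivable_within_continuous => s; rewrite in_itv/= => s01.
  by have := dD _ s01 => -[].
have [c] := EVT_min ler01 cD.
rewrite in_itv/= => c01 Dc.
apply: (le_trans _ (Dc t _)); last by rewrite in_itv/=.
have Hc := H _ c01; have rc := r0 _ c01.
suff e0 : c * (1 - c ^+ 2) * D' c = 0.
  by move: Hc; rewrite e0 add0r pmulr_rge0.
have [->|c0] := eqVneq c 0; first by rewrite !mul0r.
have [->|c1] := eqVneq c 1; first by rewrite expr1n subrr mulr0 mul0r.
have ci : c \in `]0, 1[.
  by rewrite in_itv/= !lt_neqAle c1 eq_sym c0.
have [] := @derive1_at_min _ D 0 1 c ler01 _ ci _.
- by move=> s; rewrite in_itv/= => /andP[s0 s1]; have [] := dD s; rewrite ?ltW.
- by move=> s; rewrite in_itv/= => /andP[s0 s1]; apply: Dc; rewrite in_itv/= !ltW.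
move=> _; have [_ ->] := dD _ c01.
by move=> ->; rewrite mulr0.
Qed.

(** Taylor coefficients of the hypergeometric polynomial [2F1(2, -k; k+3; t)], scaled to the value
    [(2k+1) / (2(k+2))] that the ODE forces at 0. The ODE itself gives a three-term recurrence,
    which this two-term one implies. *)
Fixpoint profile_coef k (j : nat) : R :=
  if j is i.+1 then
    - profile_coef k i * (i.+2)%:R * (k%:R - i%:R) / (i.+1%:R * (k + i + 3)%:R)
  else (k.*2.+1)%:R / (2 * (k.+2)%:R).

Lemma profile_coef_gt k j : (k < j)%N -> profile_coef k j = 0.
Proof.
elim: j => // j IH; rewrite ltnS leq_eqVlt => /orP[/eqP<-|/IH /= ->].
  by rewrite /= subrr mulr0 mul0r.
by rewrite oppr0 !mul0r.
Qed.

(* The recursion stops at degree [k] because of its factor [k%:R - i%:R]. *)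
Definition profile k : {poly R} := \poly_(j < k.+1) profile_coef k j.

Lemma coef_profile k j : (profile k)`_j = profile_coef k j.
Proof.
by rewrite coef_poly ltnS; case: leqP => // /profile_coef_gt ->.
Qed.

Lemma profile_rec0 k : (k%:R + 2) * profile_coef k 0 = (2 * k%:R + 1) / 2.
Proof.
have k2 : k%:R + 2 != 0 :> R by rewrite -natrD pnatr_eq0 addn2.
have -> : profile_coef k 0 = (2 * k%:R + 1) / (2 * (k%:R + 2)).
  by rewrite /= -natrD addn2 -addn1 natrD -mul2n natrM.
by field.
Qed.

Lemma profile_recS k j :
  (j.+1%:R * (k%:R + j%:R + 3)) * profile_coef k j.+1 =
  - (j%:R + 2) * (k%:R - j%:R) * profile_coef k j.
Proof.
have k2 : k%:R + j%:R + 3 != 0 :> R by rewrite -!natrD pnatr_eq0 addn3.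
have j1 : j%:R + 1 != 0 :> R by rewrite natr1 pnatr_eq0.
rewrite /= !natrD -[j.+2%:R]natr1 -[j.+1%:R]natr1; field.
by rewrite k2 j1.
Qed.

Lemma profile_rec1 k :
  (k%:R + 3) * profile_coef k 1 + 2 * k%:R * profile_coef k 0 = 0.
Proof. by have := profile_recS k 0; rewrite addr0 subr0 mul1r add0r => ->; ring. Qed.

(** Coefficient of [t^(j+2)] in the ODE. After multiplication by [j + 2], the two-term recursions at
    [j] and [j + 1] turn every term into a multiple of coefficient [j + 1], and the multiples
    cancel. *)
Lemma profile_rec2 k j :
  (j%:R + k%:R + 4) * profile_coef k j.+2 + 2 * k%:R * profile_coef k j.+1
  + (k%:R - j%:R) * profile_coef k j = 0.
Proof.
have j2 : j%:R + 2 != 0 :> R by rewrite -natrD pnatr_eq0 addn2.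
have h1 := profile_recS k j.+1; have h2 := profile_recS k j.
rewrite -[j.+2%:R]natr1 -[j.+1%:R]natr1 in h1.
rewrite -[j.+1%:R]natr1 in h2.
apply: (mulfI j2); rewrite mulr0.
transitivity ((j%:R + 1 + 1) * (k%:R + (j%:R + 1) + 3) * profile_coef k j.+2
  + 2 * k%:R * (j%:R + 2) * profile_coef k j.+1
  - (- (j%:R + 2) * (k%:R - j%:R) * profile_coef k j)); first by ring.
rewrite h1 -h2; ring.
Qed.

Lemma profile_ode_poly k : let b := profile k in
  'X * b^`() - 'X^3 * b^`() + (k%:R + 2) *: b + (2 * k%:R) *: ('X * b)
  + k%:R *: ('X^2 * b) = ((2 * k%:R + 1) / 2)%:P.
Proof.
move=> b; have -> : 'X^3 * b^`() = 'X^2 * ('X * b^`()) by rewrite mulrA -exprSr.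
apply/polyP => -[|[|j]]; rewrite !(coefD, coefB, coefN, coefZ, coefXM, coefXnM, coefC) /=
  ?coef_deriv ?coef_profile.
- by rewrite -profile_rec0; ring.
- rewrite -[X in _ = X](profile_rec1 k); ring.
- rewrite subn2 /= -[X in _ = X](profile_rec2 k j).
  case: j => [|j] /=; first by rewrite -(mulr_natr _ 2); ring.
  by rewrite -(mulr_natr _ j.+3) -(mulr_natr _ j.+1); ring.
Qed.

Lemma profile_ode k t :
  t * (1 - t ^+ 2) * (profile k)^`().[t]
  + (k%:R + 2 + 2 * k%:R * t + k%:R * t ^+ 2) * (profile k).[t]
  = (2 * k%:R + 1) / 2.
Proof.
have /(congr1 (fun p => p.[t])) := profile_ode_poly k.
rewrite !(hornerD, hornerN, hornerZ, hornerM, hornerX, hornerXn, hornerC) => <-.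
ring.
Qed.

(** The curvature contains the second derivative of b, which is eliminated through this
    differentiated ODE. *)
Lemma profile_dode k t :
  t * (1 - t ^+ 2) * (profile k)^`()^`().[t] + (1 - 3 * t ^+ 2) * (profile k)^`().[t]
  + (k%:R + 2 + 2 * k%:R * t + k%:R * t ^+ 2) * (profile k)^`().[t]
  + (2 * k%:R + 2 * k%:R * t) * (profile k).[t] = 0.
Proof.
have /(congr1 (fun p => p^`().[t])) := profile_ode_poly k.
rewrite !(derivD, derivN, derivZ, derivM, derivX, derivXn, derivC).
rewrite !(hornerD, hornerN, hornerZ, hornerM, hornerX, hornerXn, hornerC, hornerMn) => <-.
ring.
Qed.

End Profile.

(** * Comparison of b with rational functions *)

Section ProfileBounds.
Context {R : realType} (k : nat).
Hypothesis k_gt0 : (0 < k)%N.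
Local Notation K := (k%:R : R).
Local Notation b := (@profile R k).
Local Notation r t := (K + 2 + 2 * K * t + K * t ^+ 2).

Let K_ge1 : 1 <= K. Proof. by rewrite ler1n. Qed.

Let r_gt0 t : 0 <= t <= 1 -> 0 < r t.
Proof.
move=> /andP[t0 _]; have Kt : 0 <= K * t by rewrite mulr_ge0.
have Kt2 : 0 <= K * t ^+ 2 by rewrite mulr_ge0 ?sqr_ge0.
have K1 := K_ge1. by lra.
Qed.

Lemma profile_bound_derive (c : R) (Q : {poly R}) t : Q.[t] != 0 ->
  is_derive t 1 (fun s => c / Q.[s] - b.[s]) (- c * Q^`().[t] / Q.[t] ^+ 2 - b^`().[t]).
Proof.
move=> Q0; have dQ : is_derive t 1 (fun s => Q.[s]^-1) (- Q.[t] ^- 2 *: Q^`().[t]).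
  exact: is_deriveV.
have dcQ : is_derive t 1 (fun s => c / Q.[s]) (c *: (- Q.[t] ^- 2 *: Q^`().[t])).
  exact: is_deriveZ.
apply: is_derive_eq; rewrite /GRing.scale /=; field; exact: Q0.
Qed.

(** The second hypothesis says, with [Q^2] cleared, that [c / Q] is a supersolution of the ODE; the
    maximum principle applies to [c / Q - b]. *)
Lemma profile_le (c : R) (Q : {poly R}) :
  (forall t, 0 <= t <= 1 -> 0 < Q.[t]) ->
  (forall t, 0 <= t <= 1 ->
     (2 * K + 1) / 2 * Q.[t] ^+ 2 <= c * (r t * Q.[t] - t * (1 - t ^+ 2) * Q^`().[t])) ->
  forall t, 0 <= t <= 1 -> b.[t] <= c / Q.[t].
Proof.
move=> Q0 H t t01; rewrite -subr_ge0.
apply: (@singular_max_principle _ (fun s => c / Q.[s] - b.[s]) _ (fun s => r s)) t01.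
- by move=> s s01; apply: profile_bound_derive; rewrite gt_eqF// Q0.
- by move=> s s01; exact: r_gt0.
move=> s s01; have := H _ s01; have Qs := Q0 _ s01; have := profile_ode k s.
set B' := b^`().[s]; set B := b.[s]; set q := Q.[s] in Qs *; set q' := Q^`().[s].
move=> ode Hs.
rewrite (_ : _ + _ = (c * (r s * q - s * (1 - s ^+ 2) * q')
   - (s * (1 - s ^+ 2) * B' + r s * B) * q ^+ 2) / q ^+ 2).
  by rewrite ode divr_ge0 ?subr_ge0 ?sqr_ge0.
by field; rewrite gt_eqF.
Qed.

Lemma profile_ge (c : R) (Q : {poly R}) :
  (forall t, 0 <= t <= 1 -> 0 < Q.[t]) ->
  (forall t, 0 <= t <= 1 ->
     c * (r t * Q.[t] - t * (1 - t ^+ 2) * Q^`().[t]) <= (2 * K + 1) / 2 * Q.[t] ^+ 2) ->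
  forall t, 0 <= t <= 1 -> c / Q.[t] <= b.[t].
Proof.
move=> Q0 H t t01; rewrite -subr_ge0 -opprB.
apply: (@singular_max_principle _ (fun s => - (c / Q.[s] - b.[s])) (fun s => - _) (fun s => r s)) t01.
- move=> s s01; apply: is_deriveN; apply: profile_bound_derive.
  by rewrite gt_eqF// Q0.
- by move=> s s01; exact: r_gt0.
move=> s s01; have := H _ s01; have Qs := Q0 _ s01; have := profile_ode k s.
set B' := b^`().[s]; set B := b.[s]; set q := Q.[s] in Qs *; set q' := Q^`().[s].
move=> ode Hs.
rewrite (_ : _ + _ = ((s * (1 - s ^+ 2) * B' + r s * B) * q ^+ 2
   - c * (r s * q - s * (1 - s ^+ 2) * q')) / q ^+ 2).
  by rewrite ode divr_ge0 ?subr_ge0 ?sqr_ge0.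
by field; rewrite gt_eqF.
Qed.

Let quad (a0 a1 a2 : R) : {poly R} := a0%:P + a1 *: 'X + a2 *: 'X^2.
Let quadE a0 a1 a2 t : (quad a0 a1 a2).[t] = a0 + a1 * t + a2 * t ^+ 2.
Proof. by rewrite /quad !(hornerD, hornerZ, hornerC, hornerX, hornerXn). Qed.
Let dquadE a0 a1 a2 t : (quad a0 a1 a2)^`().[t] = a1 + 2 * a2 * t.
Proof.
rewrite /quad !(derivD, derivZ, derivC, derivX, derivXn) /=.
rewrite !(hornerD, hornerZ, hornerC, hornerX, hornerMn).
by rewrite -mulr_natl; ring.
Qed.
Let mixE (a c t : R) :
  a * (1 - t) ^+ 2 + c * (1 + t) ^+ 2 = (quad (a + c) (2 * (c - a)) (a + c)).[t].
Proof. by rewrite quadE; ring. Qed.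
Let mix_gt0 (a c t : R) : 0 <= a -> 0 < c -> 0 <= t ->
  0 < a * (1 - t) ^+ 2 + c * (1 + t) ^+ 2.
Proof.
move=> a0 c0 t0.
have p1 : 0 < c * (1 + t) ^+ 2 by rewrite mulr_gt0 ?exprn_gt0//; lra.
have p2 : 0 <= a * (1 - t) ^+ 2 by rewrite mulr_ge0 ?sqr_ge0.
lra.
Qed.

Local Notation m := (2 * K + 1).

(** The bound has the values of b at both ends, [m / (m + 3)] and [1 / 4]. It is equivalent to
    [weyl_hor + weyl_mix <= 0], the form in which it is used. *)
Lemma profile_ub t : 0 <= t <= 1 ->
  b.[t] <= m / (3 * (1 - t) ^+ 2 + m * (1 + t) ^+ 2).
Proof.
have K1 := K_ge1.
move=> t01; rewrite mixE; apply: profile_le t01 => s s01.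
  by case/andP: s01 => s0 s1; rewrite -mixE mix_gt0//; lra.
case/andP: s01 => s0 s1; rewrite quadE dquadE -subr_ge0.
rewrite (_ : _ - _ = 12 * m * s * (1 - s) ^+ 2); last by field.
by rewrite !mulr_ge0// ?sqr_ge0//; lra.
Qed.

(** Again exact at both ends. The denominator is what [weyl_cross <= 6 * X] demands, with
    [X = (1 - t)^2 b]. *)
Lemma profile_lb t : 0 <= t <= 1 ->
  m / (m * (1 + t) ^+ 2 + (1 - t) * (3 + t)) <= b.[t].
Proof.
have K1 := K_ge1.
pose Q := quad (m + 3) (2 * m - 2) (m - 1).
have QE s : Q.[s] = m * (1 + s) ^+ 2 + (1 - s) * (3 + s) by rewrite quadE; ring.
have dQE s : Q^`().[s] = 2 * m * (1 + s) - 2 - 2 * s.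
  by rewrite dquadE; ring.
move=> t01; rewrite -QE; apply: profile_ge t01 => s /andP[s0 s1]; rewrite QE.
  have p1 : 0 < m * (1 + s) ^+ 2 by rewrite mulr_gt0 ?exprn_gt0//; lra.
  have p2 : 0 <= (1 - s) * (3 + s) by rewrite mulr_ge0//; lra.
  lra.
rewrite dQE -subr_ge0.
rewrite (_ : _ - _ = 2 * m * (2 * K) * s * (1 + s) ^+ 2 * (1 - s)); last by field.
by rewrite !mulr_ge0// ?sqr_ge0//; lra.
Qed.

(** Equivalent to [3 * X - weyl_rad <= 1], which the lower curvature bound needs once the cross term
    has been absorbed into a square. For [k = 1] it only says that b is nonnegative. *)
Lemma profile_lb' t : 0 <= t <= 1 ->
  m * (K - 1) / (3 * (K - 1) * (1 - t) ^+ 2 + K * (2 * K - 1) * (1 + t) ^+ 2) <= b.[t].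
Proof.
have K1 := K_ge1.
move=> t01; rewrite mixE; apply: profile_ge t01 => s s01.
  by case/andP: s01 => s0 s1; rewrite -mixE mix_gt0//; [lra|apply: mulr_gt0; lra].
case/andP: s01 => s0 s1; rewrite quadE dquadE -subr_ge0.
(* The defect is a quadratic form in [(1 + s)^2] and [(1 - s)^2]. Completing the square leaves the
   factor [12 K^2 + 84 K - 81], positive for [K >= 1]. *)
rewrite (_ : _ - _ = m / 2 * ((2 * K * (2 * K - 1) * (1 + s) ^+ 2
      - 3 * (K - 1) * (2 * K - 3) * (1 - s) ^+ 2) ^+ 2
    + (K - 1) ^+ 2 * (12 * K ^+ 2 + 84 * K - 81) * (1 - s) ^+ 4) / (4 * K * (2 * K - 1)));
  last by field; rewrite !gt_eqF//; lra.
have K2 : 0 <= 12 * K ^+ 2 + 84 * K - 81 by nra.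
have K3 : 0 <= 4 * K * (2 * K - 1) by apply: mulr_ge0; lra.
apply: divr_ge0 => //; apply: mulr_ge0; first lra.
by rewrite addr_ge0 ?sqr_ge0// mulr_ge0 ?exprn_even_ge0// mulr_ge0 ?sqr_ge0.
Qed.

Lemma profile0 : b.[0] = m / (2 * (K + 2)).
Proof.
have K1 := K_ge1.
have := profile_ode k (0 : R); rewrite mul0r expr0n !mulr0 !addr0 mul0r add0r => h.
have K2 : K + 2 != 0 by rewrite gt_eqF//; lra.
by apply: (mulfI K2); rewrite h; field.
Qed.
End ProfileBounds.

(** * Euclidean product and Hopf rotation *)

Section EuclideanAlgebra.
Context {R : realType} {n : nat}.
Local Notation pt := 'rV[R]_n.+1.
Local Notation ec := (@ecoord R n).
Implicit Types (a : R) (u v w x : pt).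

Lemma edotC u v : edot u v = edot v u.
Proof. by apply: eq_bigr => i _; rewrite mulrC. Qed.

Lemma edotDl u v w : edot (u + v) w = edot u w + edot v w.
Proof. by rewrite -big_split; apply: eq_bigr => i _; rewrite mxE mulrDl. Qed.

Lemma edotZl a u v : edot (a *: u) v = a * edot u v.
Proof. by rewrite mulr_sumr; apply: eq_bigr => i _; rewrite mxE mulrA. Qed.

Lemma edotDr u v w : edot u (v + w) = edot u v + edot u w.
Proof. by rewrite edotC edotDl !(edotC u). Qed.

Lemma edotZr a u v : edot u (a *: v) = a * edot u v.
Proof. by rewrite edotC edotZl edotC. Qed.

Lemma edotNl u v : edot (- u) v = - edot u v.
Proof. by rewrite -scaleN1r edotZl mulN1r. Qed.

Lemma edotNr u v : edot u (- v) = - edot u v.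
Proof. by rewrite edotC edotNl edotC. Qed.

Lemma edot0l u : edot 0 u = 0.
Proof. by rewrite -(scale0r u) edotZl mul0r. Qed.

Lemma edot0r u : edot u 0 = 0.
Proof. by rewrite edotC edot0l. Qed.

Definition edotE := (edotDl, edotDr, edotZl, edotZr, edotNl, edotNr).

Lemma edot_ge0 u : 0 <= edot u u.
Proof. by apply: sumr_ge0 => i _; rewrite -expr2 sqr_ge0. Qed.

Lemma edot_eq0 u : (edot u u == 0) = (u == 0).
Proof.
apply/eqP/eqP => [|->]; last by rewrite edot0l.
move/psumr_eq0P => h; apply/rowP => i; rewrite mxE.
by apply/eqP; rewrite -sqrf_eq0 expr2 h// => j _; rewrite -expr2 sqr_ge0.
Qed.

Lemma edot_gt0 u : (0 < edot u u) = (u != 0).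
Proof. by rewrite lt_neqAle edot_ge0 andbT eq_sym edot_eq0. Qed.

Lemma edot_ecoordr u i : edot u (ec i) = u 0 i.
Proof.
rewrite /edot (bigD1 i)//= /ecoord mxE !eqxx mulr1 big1 ?addr0// => j ji.
by rewrite mxE eqxx (negbTE ji) mulr0.
Qed.

Lemma rv_ecoord u : u = \sum_i u 0 i *: ec i.
Proof. exact: row_sum_delta. Qed.

Lemma sum_edot_ecoord u v : \sum_i edot u (ec i) * edot v (ec i) = edot u v.
Proof. by apply: eq_bigr => i _; rewrite !edot_ecoordr. Qed.

Lemma sum_ecoord_sq : \sum_i edot (ec i) (ec i) = n.+1%:R :> R.
Proof.
under eq_bigr => i _ do rewrite edot_ecoordr mxE !eqxx /=.
by rewrite sumr_const card_ord.
Qed.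

(** The device that removes indices: contraction with coordinate vectors becomes evaluation at a
    vector, so matrix and tensor sums turn into the invariant forms below. *)
Lemma sum_linear (f : pt -> R) u :
  (forall a v w, f (a *: v + w) = a * f v + f w) ->
  \sum_i u 0 i * f (ec i) = f u.
Proof.
move=> f_lin.
have f0 : f 0 = 0 by have := f_lin (- 1) 0 0; rewrite scaler0 addr0 mulN1r addNr.
have fD v w : f (v + w) = f v + f w by have := f_lin 1 v w; rewrite scale1r mul1r.
have fZ a v : f (a *: v) = a * f v by have := f_lin a v 0; rewrite f0 !addr0.
rewrite [in RHS](rv_ecoord u) (big_morph f fD f0).
by apply: eq_bigr => i _; rewrite fZ.
Qed.

Lemma edot_cauchy u v : edot u v ^+ 2 <= edot u u * edot v v.
Proof.
have [->|u0] := eqVneq u 0; first by rewrite !edot0l mul0r expr0n.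
have uu : 0 < edot u u by rewrite edot_gt0.
have := edot_ge0 (edot u u *: v - edot u v *: u).
rewrite !edotE (edotC v u).
rewrite [X in 0 <= X -> _](_ : _ = edot u u * (edot u u * edot v v - edot u v ^+ 2)); last by ring.
by rewrite pmulr_rge0// subr_ge0.
Qed.

End EuclideanAlgebra.

Section HopfRotation.
Context {R : realType} {n : nat}.
Hypothesis n_odd : odd n.
Local Notation pt := 'rV[R]_n.+1.
Local Notation J := (@Jrot R n).
Implicit Types (a : R) (u v w x : pt).

Lemma Jrot_linear a u v : J (a *: u + v) = a *: J u + J v.
Proof. by apply/rowP => i; rewrite !mxE; case: ifP => _; rewrite ?opprD ?mulrN. Qed.

Lemma JrotD u v : J (u + v) = J u + J v.
Proof. by rewrite -{1}(scale1r u) Jrot_linear scale1r. Qed.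

Lemma Jrot0 : J 0 = 0.
Proof. by apply/rowP => i; rewrite !mxE; case: ifP => _; rewrite ?oppr0. Qed.

Lemma JrotZ a u : J (a *: u) = a *: J u.
Proof. by rewrite -(addr0 (a *: u)) Jrot_linear Jrot0 addr0. Qed.

Lemma JrotN u : J (- u) = - J u.
Proof. by rewrite -scaleN1r JrotZ scaleN1r. Qed.

Let swap (i : 'I_n.+1) : 'I_n.+1 := if odd i then inord i.-1 else inord i.+1.

Let val_swap i : swap i = (if odd i then i.-1 else i.+1) :> nat.
Proof.
rewrite /swap; case: ifP => oi; rewrite inordK//; have := ltn_ord i; first lia.
(* An even index cannot be the last one because [n] is odd; otherwise [inord] would fall back to its
   default and [swap] would not be an involution. *)
rewrite ltnS leq_eqVlt => /orP[/eqP h|//]; move: oi; rewrite h n_odd//.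
Qed.

Let odd_swap i : odd (swap i) = ~~ odd i.
Proof. by rewrite val_swap; case: ifP => /= [|-> //]; case: (i : nat) => //= j /negbTE->. Qed.

Let swapK : involutive swap.
Proof.
move=> i; apply: val_inj; rewrite /= val_swap odd_swap val_swap.
by case: (boolP (odd i)) => oi //=; rewrite prednK ?odd_gt0.
Qed.

Let JrotE u i : J u 0 i = (-1) ^+ (~~ odd i) * u 0 (swap i).
Proof. by rewrite mxE /swap; case: ifP => _; rewrite ?mul1r// expr1 mulN1r. Qed.

Lemma Jrot_skew u v : edot (J u) v = - edot u (J v).
Proof.
rewrite /edot (reindex_inj (inv_inj swapK)) -sumrN; apply: eq_bigr => i _.
rewrite !JrotE swapK odd_swap negbK; case: (odd i); rewrite /= ?expr1 ?expr0; ring.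
Qed.

Lemma JrotK u : J (J u) = - u.
Proof.
apply/rowP => i; rewrite !JrotE swapK odd_swap negbK !mxE.
by case: (odd i); rewrite /= ?expr1 ?expr0; ring.
Qed.

Lemma edot_JrotJ u v : edot (J u) (J v) = edot u v.
Proof. by rewrite Jrot_skew JrotK edotNr opprK. Qed.

Lemma edot_JrotC u v : edot (J u) v = - edot (J v) u.
Proof. by rewrite Jrot_skew edotC. Qed.

Lemma edot_Jrot_self u : edot (J u) u = 0.
Proof.
have := Jrot_skew u u; rewrite (edotC u) => /eqP.
by rewrite -addr_eq0 -mulr2n mulrn_eq0 => /eqP.
Qed.

(** [u] and [J u] are orthogonal of equal length; the residual of [v] after projection to their span
    has nonnegative square. *)
Lemma bessel_Jrot u v :
  edot u v ^+ 2 + edot (J u) v ^+ 2 <= edot u u * edot v v.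
Proof.
have [->|u0] := eqVneq u 0; first by rewrite Jrot0 !edot0l mul0r expr0n addr0.
have uu : 0 < edot u u by rewrite edot_gt0.
have := edot_ge0 (edot u u *: v - edot u v *: u - edot (J u) v *: J u).
rewrite !edotE edot_JrotJ edot_Jrot_self (edotC u (J u)) edot_Jrot_self.
rewrite (edotC v u) (edotC v (J u)).
rewrite [X in 0 <= X -> _](_ : _ = edot u u *
  (edot u u * edot v v - (edot u v ^+ 2 + edot (J u) v ^+ 2))); last by ring.
by rewrite pmulr_rge0// subr_ge0.
Qed.

End HopfRotation.

(** * Directional derivatives and radial coefficients *)

Section DirectionalCalculus.
Context {R : realType} {V : normedModType R}.
Implicit Types (f g : V -> R) (x v : V).

Lemma is_derive_add f g x v df dg : is_derive x v f df -> is_derive x v g dg ->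
  is_derive x v (fun y => f y + g y) (df + dg).
Proof. exact: is_deriveD. Qed.

Lemma is_derive_opp f x v df : is_derive x v f df ->
  is_derive x v (fun y => - f y) (- df).
Proof. exact: is_deriveN. Qed.

Lemma is_derive_mul f g x v df dg : is_derive x v f df -> is_derive x v g dg ->
  is_derive x v (fun y => f y * g y) (f x * dg + g x * df).
Proof. exact: is_deriveM. Qed.

Lemma is_derive_const (a : R) x v : is_derive x v (fun=> a) 0.
Proof. exact: is_derive_cst. Qed.

(** The two difference quotients are literally the same function of the increment. On a line the
    pairings become polynomials in [s]. *)
Lemma is_derive_line f x v df :
  is_derive x v f df <-> is_derive (0 : R) 1 (fun s => f (s *: v + x)) df.
Proof.
have E : (fun h : R => h^-1 *: ((f \o shift x) (h *: v) - f x)) =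
   (fun h : R => h^-1 *: (((fun s : R => f (s *: v + x)) \o shift 0) (h *: 1)
      - (fun s : R => f (s *: v + x)) 0)).
  by apply/funext => h /=; rewrite addr0 scale0r add0r [_%:A]mulr1.
by split=> -[h1 h2]; constructor; move: h1 h2; rewrite /derivable /derive E.
Qed.

Lemma is_derive_compR (p : R -> R) f x v dp df :
  is_derive (f x) 1 p dp -> is_derive x v f df ->
  is_derive x v (fun y => p (f y)) (dp * df).
Proof.
move=> hp /is_derive_line hf; apply/is_derive_line.
apply: (@is_derive1_comp _ p (fun s => f (s *: v + x))) => //.
by rewrite scale0r add0r.
Qed.

End DirectionalCalculus.

Section DotCalculus.
Context {R : realType} {n : nat}.
Local Notation pt := 'rV[R]_n.+1.
Local Notation J := (@Jrot R n).
Implicit Types (u v w x z : pt).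

Lemma is_derive_edotl u x z : is_derive x z (fun y => edot y u) (edot z u).
Proof.
apply/is_derive_line.
rewrite (_ : (fun _ => _) = (fun s : R => s * edot z u + edot x u)).
  refine (is_derive_eq (is_derive_add (is_derive_mul (is_derive_id _ _)
    (is_derive_const _ _ _)) (is_derive_const _ _ _)) _).
  by ring.
by apply/funext => s; rewrite edotDl edotZl.
Qed.

Lemma is_derive_edot_Jrot u x z : is_derive x z (fun y => edot (J y) u) (edot (J z) u).
Proof.
apply/is_derive_line.
rewrite (_ : (fun _ => _) = (fun s : R => s * edot (J z) u + edot (J x) u)).
  refine (is_derive_eq (is_derive_add (is_derive_mul (is_derive_id _ _)
    (is_derive_const _ _ _)) (is_derive_const _ _ _)) _).
  by ring.
by apply/funext => s; rewrite Jrot_linear edotDl edotZl.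
Qed.

Lemma is_derive_sqnorm x z : is_derive x z (fun y => edot y y) (2 * edot x z).
Proof.
apply/is_derive_line.
rewrite (_ : (fun _ => _) =
  (fun s : R => s * (s * edot z z) + s * (2 * edot x z) + edot x x)).
  refine (is_derive_eq (is_derive_add (is_derive_add (is_derive_mul (is_derive_id _ _)
    (is_derive_mul (is_derive_id _ _) (is_derive_const _ _ _))) (is_derive_mul
    (is_derive_id _ _) (is_derive_const _ _ _))) (is_derive_const _ _ _)) _).
  by ring.
by apply/funext => s; rewrite !edotE (edotC z x); ring.
Qed.

Lemma is_derive_radial (p : R -> R) dp x z : is_derive (edot x x) 1 p dp ->
  is_derive x z (fun y => p (edot y y)) (dp * (2 * edot x z)).
Proof. by move=> hp; apply: is_derive_compR (is_derive_sqnorm x z). Qed.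

End DotCalculus.

Section RadialCoefficients.
Context {R : realType} (P : {poly R}).
Implicit Types (t : R).

(* [pr] and [pre] are d and e of the introduction, [conf] is the conformal factor,
   and [ch1, ..., ch6] are the coefficients of the Christoffel symbols with
   respect to the six invariant forms of [chform] below. *)
Definition pr t : R := P.[t].
Definition pr1 t : R := P^`().[t].
Definition pr2 t : R := P^`()^`().[t].
Definition pre t : R := 1 - t * pr t.
Definition conf t : R := 4 / (1 - t) ^+ 2.
Definition prq t : R := (pr1 t + pr t ^+ 2) / pre t.
Definition ch1 t : R := 2 / (1 - t).
Definition ch2 t : R := pr t - ch1 t * pre t.
Definition ch3 t : R := prq t - ch1 t * pr t.
Definition ch4 t : R := - prq t.
Definition ch5 t : R := pre t * (ch1 t * pr t + pr1 t) - 2 * pr t ^+ 2.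
Definition ch6 t : R := - pr t.

Definition dpre t : R := - (pr t + t * pr1 t).
Definition dprq t : R :=
  ((pr2 t + 2 * pr t * pr1 t) * pre t - (pr1 t + pr t ^+ 2) * dpre t) / pre t ^+ 2.
Definition dch1 t : R := ch1 t ^+ 2 / 2.
Definition dch2 t : R := pr1 t - (dch1 t * pre t + ch1 t * dpre t).
Definition dch3 t : R := dprq t - (dch1 t * pr t + ch1 t * pr1 t).
Definition dch4 t : R := - dprq t.
Definition dch5 t : R := dpre t * (ch1 t * pr t + pr1 t)
  + pre t * (dch1 t * pr t + ch1 t * pr1 t + pr2 t) - 4 * pr t * pr1 t.
Definition dch6 t : R := - pr1 t.

Lemma is_derive_pr t : is_derive t 1 pr (pr1 t).
Proof. exact: is_derive_poly. Qed.

Lemma is_derive_pr1 t : is_derive t 1 pr1 (pr2 t).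
Proof. exact: is_derive_poly. Qed.

Lemma is_derive_pre t : is_derive t 1 pre (dpre t).
Proof.
refine (is_derive_eq (is_derive_add (is_derive_const 1 _ _) (is_derive_opp
  (is_derive_mul (is_derive_id _ _) (is_derive_pr _)))) _).
by rewrite /dpre; ring.
Qed.

Lemma is_derive_onem t : is_derive t (1 : R) (fun s => 1 - s) (- 1).
Proof.
refine (is_derive_eq (is_derive_add (is_derive_const 1 _ _) (is_derive_opp
  (is_derive_id _ _))) _).
by rewrite add0r.
Qed.

Lemma is_derive_onemV t : t != 1 -> is_derive t 1 (fun s : R => (1 - s)^-1) ((1 - t) ^- 2).
Proof.
move=> t1; have t1' : 1 - t != 0 by rewrite subr_eq0 eq_sym.
refine (is_derive_eq (@is_deriveV _ (fun s => 1 - s) t _ 1 t1' (is_derive_onem t)) _).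
by rewrite /GRing.scale /= mulrN1 opprK.
Qed.

Lemma is_derive_preV t : pre t != 0 ->
  is_derive t 1 (fun s => (pre s)^-1) (- dpre t / pre t ^+ 2).
Proof.
move=> e0; refine (is_derive_eq (@is_deriveV _ pre t _ 1 e0 (is_derive_pre t)) _).
by rewrite /GRing.scale /=; field.
Qed.

Lemma is_derive_ch1 t : t != 1 -> is_derive t 1 ch1 (dch1 t).
Proof.
move=> t1; have t1' : 1 - t != 0 by rewrite subr_eq0 eq_sym.
refine (is_derive_eq (is_derive_mul (is_derive_const 2 _ _)
  (is_derive_onemV t1)) _).
by rewrite /dch1 /ch1; field.
Qed.

Lemma is_derive_conf t : t != 1 -> is_derive t 1 conf (conf t * ch1 t).
Proof.
move=> t1; have t1' : 1 - t != 0 by rewrite subr_eq0 eq_sym.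
have V := is_derive_onemV t1.
rewrite (_ : conf = fun s => 4 * ((1 - s)^-1 * (1 - s)^-1)).
  refine (is_derive_eq (is_derive_mul (is_derive_const 4 _ _) (is_derive_mul V V)) _).
  by rewrite /conf /ch1; field.
by apply/funext => s; rewrite /conf expr2 invfM.
Qed.

Lemma is_derive_prq t : pre t != 0 -> is_derive t 1 prq (dprq t).
Proof.
move=> e0; rewrite (_ : prq = fun s => (pr1 s + pr s * pr s) * (pre s)^-1).
  refine (is_derive_eq (is_derive_mul (is_derive_add (is_derive_pr1 _)
    (is_derive_mul (is_derive_pr _) (is_derive_pr _)))
    (is_derive_preV e0)) _).
  by rewrite /dprq; field.
by apply/funext => s; rewrite /prq expr2.
Qed.

(** This is what [prq] stands for: since [pre = 1 - t * pr], the quotient rule for [pr / pre] has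
    numerator [pr' + pr^2], all terms with the factor [t * pr * pr'] cancelling. *)
Lemma is_derive_prV t : pre t != 0 ->
  is_derive t 1 (fun s => pr s / pre s) (prq t / pre t).
Proof.
move=> e0.
refine (is_derive_eq (is_derive_mul (is_derive_pr _)
   (is_derive_preV e0)) _).
by rewrite /prq /dpre /pre in e0 *; field.
Qed.

Lemma is_derive_ch2 t : t != 1 -> is_derive t 1 ch2 (dch2 t).
Proof.
move=> t1; refine (is_derive_eq (is_derive_add (is_derive_pr _) (is_derive_opp
  (is_derive_mul (is_derive_ch1 t1) (is_derive_pre _)))) _).
by rewrite /dch2; ring.
Qed.

Lemma is_derive_ch3 t : t != 1 -> pre t != 0 -> is_derive t 1 ch3 (dch3 t).
Proof.
move=> t1 e0; refine (is_derive_eq (is_derive_add (is_derive_prq e0) (is_derive_opp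
  (is_derive_mul (is_derive_ch1 t1) (is_derive_pr _)))) _).
by rewrite /dch3; ring.
Qed.

Lemma is_derive_ch4 t : pre t != 0 -> is_derive t 1 ch4 (dch4 t).
Proof. by move=> e0; exact: is_derive_opp (is_derive_prq e0). Qed.

Lemma is_derive_ch5 t : t != 1 -> is_derive t 1 ch5 (dch5 t).
Proof.
move=> t1; rewrite (_ : ch5 = fun s =>
  pre s * (ch1 s * pr s + pr1 s) + - (2 * (pr s * pr s))).
  refine (is_derive_eq (is_derive_add (is_derive_mul (is_derive_pre _)
    (is_derive_add (is_derive_mul (is_derive_ch1 t1) (is_derive_pr _)) (is_derive_pr1 _)))
    (is_derive_opp (is_derive_mul (is_derive_const _ _ _)
       (is_derive_mul (is_derive_pr _) (is_derive_pr _))))) _).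
  by rewrite /dch5; ring.
by apply/funext => s; rewrite /ch5 expr2.
Qed.

Lemma is_derive_ch6 t : is_derive t 1 ch6 (dch6 t).
Proof. exact: is_derive_opp (is_derive_pr t). Qed.

End RadialCoefficients.

(** * Invariant tensors and the Christoffel symbols *)

Section TensorForms.
Context {R : realType} {n : nat}.
Local Notation pt := 'rV[R]_n.+1.
Local Notation J := (@Jrot R n).
Implicit Types (u v w x z : pt).

(** Ansatz for the Christoffel symbols, paired with [w] in the Euclidean product: six terms
    symmetric in [u] and [v] and built from [x] and [J] alone. Their coefficients will depend only
    on [|x|^2]. *)
Definition chform (a1 a2 a3 a4 a5 a6 : R) x u v w : R :=
  a1 * (edot x u * edot v w + edot x v * edot u w)
  + a2 * edot u v * edot x w
  + a3 * edot x u * edot x v * edot x w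
  + a4 * (edot x u * edot (J x) v + edot x v * edot (J x) u) * edot (J x) w
  + a5 * edot (J x) u * edot (J x) v * edot x w
  + a6 * (edot (J x) v * edot (J u) w + edot (J x) u * edot (J v) w).

(** Derivative of [chform] at [x] in the direction [z] with the six coefficients frozen; their
    variation is the other summand in [is_derive_chform]. *)
Definition dchform (a1 a2 a3 a4 a5 a6 : R) x z u v w : R :=
  a1 * (edot z u * edot v w + edot z v * edot u w)
  + a2 * edot u v * edot z w
  + a3 * (edot z u * edot x v * edot x w + edot x u * edot z v * edot x w
          + edot x u * edot x v * edot z w)
  + a4 * ((edot z u * edot (J x) v + edot x u * edot (J z) v
           + edot z v * edot (J x) u + edot x v * edot (J z) u) * edot (J x) w
          + (edot x u * edot (J x) v + edot x v * edot (J x) u) * edot (J z) w)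
  + a5 * (edot (J z) u * edot (J x) v * edot x w
          + edot (J x) u * edot (J z) v * edot x w
          + edot (J x) u * edot (J x) v * edot z w)
  + a6 * (edot (J z) v * edot (J u) w + edot (J z) u * edot (J v) w).

Lemma is_derive_chform (b1 b2 b3 b4 b5 b6 : R -> R) (c1 c2 c3 c4 c5 c6 : R) x z u v w :
  is_derive (edot x x) 1 b1 c1 -> is_derive (edot x x) 1 b2 c2 ->
  is_derive (edot x x) 1 b3 c3 -> is_derive (edot x x) 1 b4 c4 ->
  is_derive (edot x x) 1 b5 c5 -> is_derive (edot x x) 1 b6 c6 ->
  let t := edot x x in let s := 2 * edot x z in
  is_derive x z (fun y => let t := edot y y in
      chform (b1 t) (b2 t) (b3 t) (b4 t) (b5 t) (b6 t) y u v w)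
    (chform (c1 * s) (c2 * s) (c3 * s) (c4 * s) (c5 * s) (c6 * s) x u v w
     + dchform (b1 t) (b2 t) (b3 t) (b4 t) (b5 t) (b6 t) x z u v w).
Proof.
move=> h1 h2 h3 h4 h5 h6 t s.
have X a : is_derive x z (fun y => edot y a) (edot z a) := is_derive_edotl a x z.
have Y a : is_derive x z (fun y => edot (J y) a) (edot (J z) a) := is_derive_edot_Jrot a x z.
have C a : is_derive x z (fun y => a) (0 : R) := is_derive_const a x z.
have H1 := is_derive_radial z h1; have H2 := is_derive_radial z h2.
have H3 := is_derive_radial z h3; have H4 := is_derive_radial z h4.
have H5 := is_derive_radial z h5; have H6 := is_derive_radial z h6.
have A := @is_derive_add R 'rV[R]_n.+1.
have M := @is_derive_mul R 'rV[R]_n.+1.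
rewrite /chform /=.
refine (is_derive_eq (A _ _ _ _ _ _ (A _ _ _ _ _ _ (A _ _ _ _ _ _ (A _ _ _ _ _ _ (A _ _ _ _ _ _
   (M _ _ _ _ _ _ H1 (A _ _ _ _ _ _ (M _ _ _ _ _ _ (X u) (C _)) (M _ _ _ _ _ _ (X v) (C _))))
   (M _ _ _ _ _ _ (M _ _ _ _ _ _ H2 (C _)) (X w)))
   (M _ _ _ _ _ _ (M _ _ _ _ _ _ (M _ _ _ _ _ _ H3 (X u)) (X v)) (X w)))
   (M _ _ _ _ _ _ (M _ _ _ _ _ _ H4 (A _ _ _ _ _ _ (M _ _ _ _ _ _ (X u) (Y v)) (M _ _ _ _ _ _ (X v) (Y u)))) (Y w)))
   (M _ _ _ _ _ _ (M _ _ _ _ _ _ (M _ _ _ _ _ _ H5 (Y u)) (Y v)) (X w)))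
   (M _ _ _ _ _ _ H6 (A _ _ _ _ _ _ (M _ _ _ _ _ _ (Y v) (C _)) (M _ _ _ _ _ _ (Y u) (C _))))) _).
rewrite /dchform -/t -/s.
ring.
Qed.

Definition chvec (a1 a2 a3 a4 a5 a6 : R) x u v : pt :=
  (a1 * edot x u) *: v + (a1 * edot x v) *: u
  + (a2 * edot u v + a3 * edot x u * edot x v + a5 * edot (J x) u * edot (J x) v) *: x
  + (a4 * (edot x u * edot (J x) v + edot x v * edot (J x) u)) *: J x
  + (a6 * edot (J x) v) *: J u + (a6 * edot (J x) u) *: J v.

Lemma edot_chvec a1 a2 a3 a4 a5 a6 x u v w :
  edot (chvec a1 a2 a3 a4 a5 a6 x u v) w = chform a1 a2 a3 a4 a5 a6 x u v w.
Proof. by rewrite /chvec !edotE /chform; ring. Qed.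

Section Linearity.
Variables (a1 a2 a3 a4 a5 a6 : R) (x : pt).
Local Notation ch := (chform a1 a2 a3 a4 a5 a6 x).
Local Notation dch := (dchform a1 a2 a3 a4 a5 a6 x).
Implicit Types (a : R).

Lemma chform_linear1 a u u' v w : ch (a *: u + u') v w = a * ch u v w + ch u' v w.
Proof. by rewrite /chform Jrot_linear !edotE; ring. Qed.

Lemma chform_linear2 a u v v' w : ch u (a *: v + v') w = a * ch u v w + ch u v' w.
Proof. by rewrite /chform Jrot_linear !edotE; ring. Qed.

Lemma chform_linear3 a u v w w' : ch u v (a *: w + w') = a * ch u v w + ch u v w'.
Proof. by rewrite /chform !edotE; ring. Qed.

Lemma dchform_linear1 a z z' u v w :
  dch (a *: z + z') u v w = a * dch z u v w + dch z' u v w.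
Proof. by rewrite /dchform Jrot_linear !edotE; ring. Qed.

Lemma dchform_linear2 a z u u' v w :
  dch z (a *: u + u') v w = a * dch z u v w + dch z u' v w.
Proof. by rewrite /dchform Jrot_linear !edotE; ring. Qed.

Lemma dchform_linear3 a z u v v' w :
  dch z u (a *: v + v') w = a * dch z u v w + dch z u v' w.
Proof. by rewrite /dchform Jrot_linear !edotE; ring. Qed.

Lemma dchform_linear4 a z u v w w' :
  dch z u v (a *: w + w') = a * dch z u v w + dch z u v w'.
Proof. by rewrite /dchform !edotE; ring. Qed.

End Linearity.

End TensorForms.

Section Metric.
Context {R : realType} {n : nat}.
Local Notation pt := 'rV[R]_n.+1.
Local Notation J := (@Jrot R n).
Local Notation ec := (@ecoord R n).
Implicit Types (u v w x z : pt).

Definition mform (k1 k2 k3 : R) x u v : R :=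
  k1 * edot u v + k2 * (edot x u * edot x v) + k3 * (edot (J x) u * edot (J x) v).

Definition dmform (k2 k3 : R) x z u v : R :=
  k2 * (edot z u * edot x v + edot x u * edot z v)
  + k3 * (edot (J z) u * edot (J x) v + edot (J x) u * edot (J z) v).

Lemma mformC k1 k2 k3 x u v : mform k1 k2 k3 x u v = mform k1 k2 k3 x v u.
Proof. by rewrite /mform (edotC u v); ring. Qed.

Lemma mform_linear k1 k2 k3 x v (a : R) u u' :
  mform k1 k2 k3 x (a *: u + u') v = a * mform k1 k2 k3 x u v + mform k1 k2 k3 x u' v.
Proof. by rewrite /mform !edotE; ring. Qed.

Lemma is_derive_mform (b1 b2 b3 : R -> R) (c1 c2 c3 : R) x z u v :
  is_derive (edot x x) 1 b1 c1 -> is_derive (edot x x) 1 b2 c2 ->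
  is_derive (edot x x) 1 b3 c3 ->
  let t := edot x x in let s := 2 * edot x z in
  is_derive x z (fun y => let t := edot y y in mform (b1 t) (b2 t) (b3 t) y u v)
    (mform (c1 * s) (c2 * s) (c3 * s) x u v + dmform (b2 t) (b3 t) x z u v).
Proof.
move=> h1 h2 h3 t s.
have X a : is_derive x z (fun y => edot y a) (edot z a) := is_derive_edotl a x z.
have Y a : is_derive x z (fun y => edot (J y) a) (edot (J z) a) := is_derive_edot_Jrot a x z.
have C a : is_derive x z (fun y => a) (0 : R) := is_derive_const a x z.
have H1 := is_derive_radial z h1; have H2 := is_derive_radial z h2.
have H3 := is_derive_radial z h3.
have A := @is_derive_add R 'rV[R]_n.+1.
have M := @is_derive_mul R 'rV[R]_n.+1.
rewrite /mform /=.
refine (is_derive_eq (A _ _ _ _ _ _ (A _ _ _ _ _ _ (M _ _ _ _ _ _ H1 (C _))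
   (M _ _ _ _ _ _ H2 (M _ _ _ _ _ _ (X u) (X v))))
   (M _ _ _ _ _ _ H3 (M _ _ _ _ _ _ (Y u) (Y v)))) _).
rewrite /dmform -/t -/s.
ring.
Qed.

Section Radial.
Variables (c : R) (P : {poly R}).
Hypothesis n_odd : odd n.
Hypothesis c_gt0 : 0 < c.
Hypothesis pre_gt0 : forall t, 0 <= t <= 1 -> 0 < pre P t.

Definition gcoef1 t : R := c * conf t.
Definition gcoef2 t : R := c * conf t * (pr P t / pre P t).
Definition gcoef3 t : R := - (c * conf t * pr P t).

Definition gform x u v :=
  let t := edot x x in mform (gcoef1 t) (gcoef2 t) (gcoef3 t) x u v.

Definition dgform x z u v :=
  let t := edot x x in let s := 2 * edot x z in
  mform (gcoef1 t * ch1 t * s)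
    ((gcoef2 t * ch1 t + gcoef1 t * (prq P t / pre P t)) * s)
    ((gcoef3 t * ch1 t - gcoef1 t * pr1 P t) * s) x u v
  + dmform (gcoef2 t) (gcoef3 t) x z u v.

Definition tn_metric x : 'M[R]_n.+1 := \matrix_(i, j) gform x (ec i) (ec j).

(** Raises an index. Compared with the metric, [pr] and [pr / pre] change places, since the radial
    and Hopf eigenvalues [1 / pre] and [pre] are reciprocal. *)
Definition igvec x u : pt :=
  let t := edot x x in
  (gcoef1 t)^-1 *: (u - (pr P t * edot x u) *: x + (pr P t / pre P t * edot (J x) u) *: J x).

Lemma ball1_sqnorm x : ball1 x -> 0 <= edot x x <= 1.
Proof. by move=> /= b1; rewrite edot_ge0 ltW. Qed.

Lemma ball1_neq1 x : ball1 x -> edot x x != 1.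
Proof. by move=> /= b1; rewrite lt_eqF. Qed.

Lemma ball1_pre x : ball1 x -> pre P (edot x x) != 0.
Proof. by move=> /ball1_sqnorm /pre_gt0; rewrite lt0r => /andP[]. Qed.

Lemma conf_gt0 (t : R) : t < 1 -> 0 < conf t.
Proof. by move=> t1; rewrite /conf divr_gt0// exprn_gt0// subr_gt0. Qed.

Lemma gcoef1_gt0 x : ball1 x -> 0 < gcoef1 (edot x x).
Proof. by move=> b; rewrite mulr_gt0// conf_gt0. Qed.

Lemma is_derive_gform x z u v : ball1 x -> is_derive x z (fun y => gform y u v) (dgform x z u v).
Proof.
move=> bx; have t1 := ball1_neq1 bx; have e0 := ball1_pre bx.
apply: is_derive_mform.
- refine (is_derive_eq (is_derive_mul (is_derive_const _ _ _) (is_derive_conf t1)) _).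
  by rewrite /gcoef1; ring.
- refine (is_derive_eq (is_derive_mul (is_derive_mul (is_derive_const _ _ _)
    (is_derive_conf t1)) (is_derive_prV e0)) _).
  by rewrite /gcoef1 /gcoef2; ring.
- refine (is_derive_eq (is_derive_opp (is_derive_mul (is_derive_mul (is_derive_const _ _ _)
    (is_derive_conf t1)) (is_derive_pr P _))) _).
  by rewrite /gcoef1 /gcoef3; ring.
Qed.

Lemma gform_igvec x u v : ball1 x -> gform x (igvec x u) v = edot u v.
Proof.
move=> bx; have e0 := ball1_pre bx; have k0 := gcoef1_gt0 bx.
rewrite /gform /igvec /mform /gcoef2 /gcoef3 -/(gcoef1 _) !edotE.
rewrite (edot_JrotJ n_odd x x) (edotC x (J x)) edot_Jrot_self//.
move: e0; rewrite /pre.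
set t := edot x x; set d := pr P t; set k := gcoef1 t in k0 *.
move=> e0; field; rewrite e0 gt_eqF//.
Qed.

Lemma bil_tn_metric x u v : bil (tn_metric x) u v = gform x u v.
Proof.
rewrite /bil mxE.
rewrite -[RHS](@sum_linear _ _ (fun w => gform x u w)).
  apply: eq_bigr => j _; rewrite [v^T _ _]mxE mulrC; congr (_ * _).
  rewrite mxE -[RHS](@sum_linear _ _ (fun w => gform x w (ec j))); last first.
    by move=> *; exact: mform_linear.
  by apply: eq_bigr => i _; rewrite mxE.
by move=> *; rewrite /gform mformC mform_linear !(mformC _ _ _ _ u).
Qed.

Definition tn_inverse x : 'M[R]_n.+1 := \matrix_(i, j) igvec x (ec i) 0 j.

Lemma tn_inverseM x : ball1 x -> tn_inverse x *m tn_metric x = 1%:M.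
Proof.
move=> bx; apply/matrixP => i j; rewrite [LHS]mxE [RHS]mxE.
under eq_bigr => k _ do rewrite [tn_inverse _ _ _]mxE [tn_metric _ _ _]mxE.
transitivity (gform x (igvec x (ec i)) (ec j)).
  apply: (@sum_linear _ _ (fun w => gform x w (ec j))) => *.
  exact: mform_linear.
rewrite gform_igvec// edot_ecoordr mxE eqxx /= eq_sym.
by case: eqP.
Qed.

Lemma invmx_tn_metric x : ball1 x -> invmx (tn_metric x) = tn_inverse x.
Proof.
move=> bx; have h := tn_inverseM bx; have [_ gu] := mulmx1_unit h.
by rewrite -[LHS]mul1mx -h -mulmxA mulmxV// mulmx1.
Qed.

Definition cform x u v w :=
  let t := edot x x in
  chform (ch1 t) (ch2 P t) (ch3 P t) (ch4 P t) (ch5 P t) (ch6 P t) x u v w.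

Definition cvec x u v :=
  let t := edot x x in
  chvec (ch1 t) (ch2 P t) (ch3 P t) (ch4 P t) (ch5 P t) (ch6 P t) x u v.

Definition dcform x z u v w :=
  let t := edot x x in let s := 2 * edot x z in
  chform (dch1 t * s) (dch2 P t * s) (dch3 P t * s) (dch4 P t * s) (dch5 P t * s) (dch6 P t * s)
    x u v w
  + dchform (ch1 t) (ch2 P t) (ch3 P t) (ch4 P t) (ch5 P t) (ch6 P t) x z u v w.

Lemma pd_tn_metric i j m x : ball1 x ->
  pd i (fun y => tn_metric y j m) x = dgform x (ec i) (ec j) (ec m).
Proof.
move=> bx; rewrite /pd (_ : (fun _ => _) = fun y => gform y (ec j) (ec m)).
  by have [] := is_derive_gform (ec i) (ec j) (ec m) bx.
by apply/funext => y; rewrite mxE.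
Qed.

(** Koszul's formula evaluated at the raised vector. All pairings are first brought to a normal form
    by symmetry, skewness and isometry of [J]. *)
Lemma koszul_tn_metric x u v w : ball1 x ->
  2^-1 * (dgform x u v (igvec x w) + dgform x v u (igvec x w) - dgform x (igvec x w) u v)
  = cform x u v w.
Proof.
move=> bx; have e0 := ball1_pre bx; have k0 := gcoef1_gt0 bx; have t1 := ball1_neq1 bx.
rewrite /dgform /igvec /cform /chform /mform /dmform.
rewrite !(JrotZ, JrotD, JrotN) JrotK// !edotE.
rewrite (edot_JrotJ n_odd x x) (edotC x (J x)) edot_Jrot_self//.
rewrite ?edot_JrotJ// ?(edotC u x) ?(edotC v x) ?(edotC w x) ?(edotC v u).
rewrite ?(edotC u (J x)) ?(edotC v (J x)) ?(edotC w (J x)).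
rewrite ?(edot_JrotC n_odd u x) ?(edot_JrotC n_odd v x) ?(edot_JrotC n_odd w x).
rewrite ?(edot_JrotC n_odd w u) ?(edot_JrotC n_odd w v) ?(edot_JrotC n_odd v u).
rewrite ?(edotC w u) ?(edotC w v).
rewrite /gcoef2 /gcoef3 -/(gcoef1 _) /ch2 /ch3 /ch4 /ch5 /ch6 /prq.
(* Each pairing now becomes a free real, so that only a rational identity is left, with the nonzero
   denominators [k] and [1 - t * d]. *)
move: e0; rewrite /pre.
move: (gcoef1 (edot x x)) k0 => k /lt0r_neq0 k0.
move: (edot x x) (ch1 (edot x x)) (pr P (edot x x)) (pr1 P (edot x x)).
move: (edot x u) (edot x v) (edot x w) (edot (J x) u) (edot (J x) v) (edot (J x) w).
move: (edot u v) (edot u w) (edot v w) (edot (J u) v) (edot (J u) w) (edot (J v) w).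
move=> uv uw vw Juv Juw Jvw xu xv xw yu yv yw t a1 d d1 e0.
by field; rewrite k0 e0.
Qed.

Lemma christ_tn_metric l i j x : ball1 x ->
  christ tn_metric l i j x = cform x (ec i) (ec j) (ec l).
Proof.
move=> bx; rewrite -koszul_tn_metric// /christ; congr (_ * _).
rewrite invmx_tn_metric//.
under eq_bigr => m _ do rewrite [tn_inverse _ _ _]mxE !pd_tn_metric//.
apply: (@sum_linear _ _ (fun w => dgform x (ec i) (ec j) w + dgform x (ec j) (ec i) w
  - dgform x w (ec i) (ec j))) => a v w.
rewrite /dgform /mform /dmform Jrot_linear !edotE; ring.
Qed.

End Radial.
End Metric.

(** * Contractions of the invariant forms *)

Section Traces.
Context {R : realType} {n : nat}.
Hypothesis n_odd : odd n.
Local Notation pt := 'rV[R]_n.+1.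
Local Notation J := (@Jrot R n).
Local Notation ec := (@ecoord R n).
Local Notation N := (n.+1%:R : R).
Implicit Types (u v w x z : pt).

Lemma sum_edot_Jrot_ecoord u v :
  \sum_i edot u (ec i) * edot (J (ec i)) v = - edot u (J v).
Proof.
rewrite -sum_edot_ecoord -sumrN; apply: eq_bigr => i _.
by rewrite edot_JrotC// [edot (J v) _]edotC; ring.
Qed.

Lemma trace_chform a1 a2 a3 a4 a5 a6 x w :
  \sum_i chform a1 a2 a3 a4 a5 a6 x (ec i) w (ec i)
  = ((N + 1) * a1 + a2 + edot x x * (a3 + a4) + a6) * edot x w.
Proof.
transitivity (\sum_i (
  (a1 * (edot x (ec i) * edot w (ec i)) + (a1 * edot x w) * edot (ec i) (ec i))
  + a2 * (edot w (ec i) * edot x (ec i))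
  + (a3 * edot x w) * (edot x (ec i) * edot x (ec i))
  + ((a4 * edot (J x) w) * (edot x (ec i) * edot (J x) (ec i))
     + (a4 * edot x w) * (edot (J x) (ec i) * edot (J x) (ec i)))
  + (a5 * edot (J x) w) * (edot (J x) (ec i) * edot x (ec i))
  + a6 * (edot (J x) (ec i) * edot (J w) (ec i)))).
  apply: eq_bigr => i _; rewrite /chform edot_Jrot_self// (edotC (ec i) w); ring.
rewrite !big_split /= -!mulr_sumr !sum_edot_ecoord sum_ecoord_sq !edot_JrotJ//.
by rewrite (edotC x (J x)) edot_Jrot_self// (edotC w x); ring.
Qed.

(** Appears in the Ricci tensor because the last term of [chform_chvec] carries [J] onto the
    contracted argument. *)
Lemma trace_chform_Jrot a1 a2 a3 a4 a5 a6 x w :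
  \sum_i chform a1 a2 a3 a4 a5 a6 x (ec i) w (J (ec i))
  = (a1 - a2 + edot x x * (a4 - a5) + (N + 1) * a6) * edot (J x) w.
Proof.
transitivity (\sum_i (
  (- a1) * (edot x (ec i) * edot (J w) (ec i))
  + (- a2) * (edot w (ec i) * edot (J x) (ec i))
  + (- a3 * edot x w) * (edot x (ec i) * edot (J x) (ec i))
  + ((a4 * edot (J x) w) * (edot x (ec i) * edot x (ec i))
     + (a4 * edot x w) * (edot (J x) (ec i) * edot x (ec i)))
  + (- a5 * edot (J x) w) * (edot (J x) (ec i) * edot (J x) (ec i))
  + ((a6 * edot (J x) w) * edot (ec i) (ec i) + a6 * (edot (J x) (ec i) * edot w (ec i))))).
  apply: eq_bigr => i _; rewrite /chform !edot_JrotJ// (edotC (ec i) (J _)) edot_Jrot_self//.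
  rewrite (edotC (ec i) w) (edotC w (J _)) (edot_JrotC n_odd _ w).
  rewrite (edotC x (J _)) (edot_JrotC n_odd _ x); ring.
rewrite !big_split /= -!mulr_sumr !sum_edot_ecoord sum_ecoord_sq !edot_JrotJ//.
rewrite (edotC x (J x)) edot_Jrot_self// (edotC w (J x)).
by rewrite (edotC x (J w)) (edot_JrotC n_odd w x); ring.
Qed.

(** Frozen-coefficient part of the divergence of the Christoffel symbols; [trace_dchform24] is the
    same for the derivative of their trace. Ricci contains the difference of the two. *)
Lemma trace_dchform14 a1 a2 a3 a4 a5 a6 x v w :
  \sum_i dchform a1 a2 a3 a4 a5 a6 x (ec i) v w (ec i)
  = (2 * a1 + N * a2 - 2 * a6) * edot v w
    + ((N + 2) * a3 - 2 * a4) * (edot x v * edot x w)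
    + (2 * a4 + (N + 2) * a5) * (edot (J x) v * edot (J x) w).
Proof.
transitivity (\sum_i (
  2 * a1 * (edot v (ec i) * edot w (ec i)) + (a2 * edot v w) * edot (ec i) (ec i)
  + ((a3 * edot x w) * (edot v (ec i) * edot x (ec i))
     + (a3 * edot x v) * (edot w (ec i) * edot x (ec i))
     + (a3 * edot x v * edot x w) * edot (ec i) (ec i))
  + ((a4 * edot (J x) w) * (edot v (ec i) * edot (J x) (ec i))
     + (a4 * edot (J x) v) * (edot w (ec i) * edot (J x) (ec i))
     + (a4 * edot x v) * (edot (J x) (ec i) * edot (J (ec i)) w)
     + (a4 * edot x w) * (edot (J x) (ec i) * edot (J (ec i)) v))
  + ((a5 * edot (J x) w) * (edot x (ec i) * edot (J (ec i)) v)
     + (a5 * edot (J x) v) * (edot x (ec i) * edot (J (ec i)) w)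
     + (a5 * edot (J x) v * edot (J x) w) * edot (ec i) (ec i))
  + (a6 * (edot (J v) (ec i) * edot (J (ec i)) w)
     + a6 * (edot (J w) (ec i) * edot (J (ec i)) v)))).
  apply: eq_bigr => i _; rewrite /dchform edot_Jrot_self//.
  rewrite (edotC (ec i) v) (edotC (ec i) w); ring.
rewrite !big_split /= -!mulr_sumr !sum_edot_ecoord !sum_edot_Jrot_ecoord sum_ecoord_sq.
rewrite !edot_JrotJ// (edotC v (J x)) (edotC w (J x)) (edotC v x) (edotC w x) (edotC w v).
rewrite (edotC x (J v)) (edotC x (J w)) (edot_JrotC n_odd v x) (edot_JrotC n_odd w x).
ring.
Qed.

Lemma trace_dchform24 a1 a2 a3 a4 a5 a6 x z w :
  \sum_i dchform a1 a2 a3 a4 a5 a6 x z (ec i) w (ec i)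
  = ((N + 1) * a1 + a2 + edot x x * (a3 + a4) + a6) * edot z w
    + 2 * (a3 + a4) * (edot x z * edot x w).
Proof.
transitivity (\sum_i (
  a1 * (edot z (ec i) * edot w (ec i)) + (a1 * edot z w) * edot (ec i) (ec i)
  + a2 * (edot w (ec i) * edot z (ec i))
  + (2 * a3 * edot x w * (edot z (ec i) * edot x (ec i))
     + (a3 * edot z w) * (edot x (ec i) * edot x (ec i)))
  + ((a4 * edot (J x) w) * (edot z (ec i) * edot (J x) (ec i))
     + (a4 * edot (J z) w) * (edot x (ec i) * edot (J x) (ec i))
     + (a4 * edot z w) * (edot (J x) (ec i) * edot (J x) (ec i))
     + 2 * a4 * edot x w * (edot (J z) (ec i) * edot (J x) (ec i))
     + (a4 * edot (J x) w) * (edot x (ec i) * edot (J z) (ec i)))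
  + ((a5 * edot (J x) w) * (edot (J z) (ec i) * edot x (ec i))
     + (a5 * edot (J z) w) * (edot (J x) (ec i) * edot x (ec i))
     + (a5 * edot (J x) w) * (edot (J x) (ec i) * edot z (ec i)))
  + a6 * (edot (J z) (ec i) * edot (J w) (ec i)))).
  apply: eq_bigr => i _; rewrite /dchform edot_Jrot_self//.
  rewrite (edotC (ec i) w); ring.
rewrite !big_split /= -!mulr_sumr !sum_edot_ecoord sum_ecoord_sq.
rewrite !edot_JrotJ// (edotC x (J x)) edot_Jrot_self// (edotC z (J x)) (edotC w z).
rewrite (edotC z x) (edotC x (J z)) (edot_JrotC n_odd z x).
ring.
Qed.

End Traces.

(** * The curvature tensor as a multilinear form *)

Section Curvature.
Context {R : realType} {n : nat}.
Variables (c : R) (P : {poly R}).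
Hypothesis n_odd : odd n.
Hypothesis c_gt0 : 0 < c.
Hypothesis pre_gt0 : forall t, 0 <= t <= 1 -> 0 < pre P t.
Local Notation pt := 'rV[R]_n.+1.
Local Notation J := (@Jrot R n).
Local Notation ec := (@ecoord R n).
Local Notation N := (n.+1%:R : R).
Local Notation g := (@tn_metric R n c P).
Implicit Types (u v w x z : pt).

Lemma continuous_edotl u : continuous (fun x : pt => edot x u).
Proof.
move=> x; apply/differentiable_continuous.
rewrite (_ : (fun _ => _) = \sum_i (fun y : pt => y 0 i * u 0 i)).
  apply: differentiable_sum => i; apply: differentiableM => //.
  exact: differentiable_coord.
by apply/funext => y; rewrite fct_sumE.
Qed.

Lemma differentiable_sqnorm (x : pt) : differentiable (fun y : pt => edot y y) x.
Proof.
rewrite (_ : (fun _ => _) = \sum_i (fun y : pt => y 0 i * y 0 i)).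
  by apply: differentiable_sum => i; apply: differentiableM; exact: differentiable_coord.
by apply/funext => y; rewrite fct_sumE.
Qed.

Lemma continuous_sqnorm : continuous (fun x : pt => edot x x).
Proof. by move=> x; apply/differentiable_continuous/differentiable_sqnorm. Qed.

Lemma open_ball1 : open (@ball1 R n).
Proof.
have -> : @ball1 R n = (fun x : pt => edot x x) @^-1` [set r | r < 1] by [].
by apply: open_comp; [move=> x _; exact: continuous_sqnorm|exact: open_lt].
Qed.

Lemma is_derive_cform x z u v w : ball1 x ->
  is_derive x z (fun y => cform P y u v w) (dcform P x z u v w).
Proof.
move=> bx; have t1 := ball1_neq1 bx; have e0 := ball1_pre pre_gt0 bx.
exact: is_derive_chform (is_derive_ch1 t1) (is_derive_ch2 P t1) (is_derive_ch3 t1 e0)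
  (is_derive_ch4 e0) (is_derive_ch5 P t1) (is_derive_ch6 P _).
Qed.

Definition rform x u v w z :=
  dcform P x u v w z - dcform P x v u w z
  + (cform P x u (cvec P x v w) z - cform P x v (cvec P x u w) z).

Lemma pd_christ i l j k x : ball1 x ->
  pd i (christ g l j k) x = dcform P x (ec i) (ec j) (ec k) (ec l).
Proof.
move=> bx; have [_ <-] := is_derive_cform (ec i) (ec j) (ec k) (ec l) bx.
(* The closed formula for [christ] is known only inside the ball; openness makes it hold near [x],
   which suffices for its derivative. *)
apply: near_eq_derive; have := open_nbhs_nbhs (conj open_ball1 bx).
by apply: filterS => y by1; rewrite christ_tn_metric.
Qed.

Lemma riem_tn_metric i j k l x : ball1 x ->
  riem g i j k l x = rform x (ec i) (ec j) (ec k) (ec l).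
Proof.
move=> bx; rewrite /riem /rform !pd_christ//; congr (_ + _).
under eq_bigr => m _ do rewrite !christ_tn_metric//.
rewrite sumrB; congr (_ - _).
- rewrite -(@sum_linear _ _ (fun u => cform P x (ec i) u (ec l))); last first.
    by move=> *; exact: chform_linear2.
  apply: eq_bigr => m _; rewrite mulrC -(edot_ecoordr (cvec _ _ (ec j) _)); congr (_ * _); exact/esym/edot_chvec.
- rewrite -(@sum_linear _ _ (fun u => cform P x (ec j) u (ec l))); last first.
    by move=> *; exact: chform_linear2.
  apply: eq_bigr => m _; rewrite mulrC -(edot_ecoordr (cvec _ _ (ec i) _)); congr (_ * _); exact/esym/edot_chvec.
Qed.

Lemma cform_linear1 (a : R) x u u' v w :
  cform P x (a *: u + u') v w = a * cform P x u v w + cform P x u' v w.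
Proof. exact: chform_linear1. Qed.
Lemma cform_linear2 (a : R) x u v v' w :
  cform P x u (a *: v + v') w = a * cform P x u v w + cform P x u v' w.
Proof. exact: chform_linear2. Qed.
Lemma cform_linear3 (a : R) x u v w w' :
  cform P x u v (a *: w + w') = a * cform P x u v w + cform P x u v w'.
Proof. exact: chform_linear3. Qed.
Lemma dcform_linear1 (a : R) x z z' u v w :
  dcform P x (a *: z + z') u v w = a * dcform P x z u v w + dcform P x z' u v w.
Proof. rewrite /dcform dchform_linear1 /chform !edotE; ring. Qed.
Lemma dcform_linear2 (a : R) x z u u' v w :
  dcform P x z (a *: u + u') v w = a * dcform P x z u v w + dcform P x z u' v w.
Proof. rewrite /dcform dchform_linear2 chform_linear1; ring. Qed.
Lemma dcform_linear3 (a : R) x z u v v' w :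
  dcform P x z u (a *: v + v') w = a * dcform P x z u v w + dcform P x z u v' w.
Proof. rewrite /dcform dchform_linear3 chform_linear2; ring. Qed.
Lemma dcform_linear4 (a : R) x z u v w w' :
  dcform P x z u v (a *: w + w') = a * dcform P x z u v w + dcform P x z u v w'.
Proof. rewrite /dcform dchform_linear4 chform_linear3; ring. Qed.

Lemma cvec_linear1 (a : R) x u u' v :
  cvec P x (a *: u + u') v = a *: cvec P x u v + cvec P x u' v.
Proof.
apply/rowP => i; rewrite -[LHS]edot_ecoordr -[RHS]edot_ecoordr [LHS]edot_chvec.
by rewrite chform_linear1 -!edot_chvec [RHS]edotDl edotZl.
Qed.
Lemma cvec_linear2 (a : R) x u v v' :
  cvec P x u (a *: v + v') = a *: cvec P x u v + cvec P x u v'.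
Proof.
apply/rowP => i; rewrite -[LHS]edot_ecoordr -[RHS]edot_ecoordr [LHS]edot_chvec.
by rewrite chform_linear2 -!edot_chvec [RHS]edotDl edotZl.
Qed.

Lemma rform_linear1 (a : R) x u u' v w z :
  rform x (a *: u + u') v w z = a * rform x u v w z + rform x u' v w z.
Proof.
rewrite /rform dcform_linear1 dcform_linear2 cform_linear1 cvec_linear1 cform_linear2.
ring.
Qed.
Lemma rform_linear2 (a : R) x u v v' w z :
  rform x u (a *: v + v') w z = a * rform x u v w z + rform x u v' w z.
Proof.
rewrite /rform dcform_linear1 dcform_linear2 cform_linear1 cvec_linear1 cform_linear2.
ring.
Qed.
Lemma rform_linear3 (a : R) x u v w w' z :
  rform x u v (a *: w + w') z = a * rform x u v w z + rform x u v w' z.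
Proof.
rewrite /rform !dcform_linear3 !cvec_linear2 !cform_linear2; ring.
Qed.
Lemma rform_linear4 (a : R) x u v w z z' :
  rform x u v w (a *: z + z') = a * rform x u v w z + rform x u v w z'.
Proof. rewrite /rform !dcform_linear4 !cform_linear3; ring. Qed.

(** Lowers an index, absorbing the factor [g x l m] of the numerator of [sec] into the last argument
    of [rform]. *)
Definition gvec x u : pt :=
  let t := edot x x in
  gcoef1 c t *: u + (gcoef2 c P t * edot x u) *: x + (gcoef3 c P t * edot (J x) u) *: J x.

Lemma edot_gvec x u v : edot (gvec x u) v = gform c P x u v.
Proof. by rewrite /gvec /gform /mform !edotE; ring. Qed.

Lemma sec_num_tn_metric x (X Y : pt) : ball1 x ->
  \sum_i \sum_j \sum_k \sum_l \sum_m
     X 0 i * Y 0 j * Y 0 k * riem g i j k l x * g x l m * X 0 m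
  = rform x X Y Y (gvec x X).
Proof.
move=> bx.
rewrite -(@sum_linear _ _ (fun u => rform x u Y Y (gvec x X))); last first.
  by move=> *; exact: rform_linear1.
apply: eq_bigr => i _.
rewrite -(@sum_linear _ _ (fun u => rform x (ec i) u Y (gvec x X))); last first.
  by move=> *; exact: rform_linear2.
rewrite mulr_sumr; apply: eq_bigr => j _.
rewrite -(@sum_linear _ _ (fun u => rform x (ec i) (ec j) u (gvec x X))); last first.
  by move=> *; exact: rform_linear3.
rewrite !mulr_sumr; apply: eq_bigr => k _.
rewrite -(@sum_linear _ _ (fun u => rform x (ec i) (ec j) (ec k) u)); last first.
  by move=> *; exact: rform_linear4.
rewrite !mulr_sumr; apply: eq_bigr => l _.
rewrite riem_tn_metric// -(edot_ecoordr (gvec x X)) edot_gvec.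
rewrite -(@sum_linear _ _ (fun u => gform c P x u (ec l))); last first.
  by move=> *; exact: mform_linear.
rewrite mulr_suml !mulr_sumr; apply: eq_bigr => m _.
rewrite [g x l m]mxE /gform mformC; ring.
Qed.

End Curvature.

(** * The numerator of the sectional curvature *)

Section CurvatureNumerator.
Context {R : realType} {n : nat}.
Variables (c : R) (P : {poly R}).
Hypothesis n_odd : odd n.
Hypothesis c_gt0 : 0 < c.
Hypothesis pre_gt0 : forall t, 0 <= t <= 1 -> 0 < pre P t.
Local Notation pt := 'rV[R]_n.+1.
Local Notation J := (@Jrot R n).
Implicit Types (u v w x z X Y : pt).

(** The quadratic Christoffel term with its inner vector eliminated: every pairing with that vector
    is again a [chform], and skewness of [J] produces the final minus sign. *)
Lemma chform_chvec (a1 a2 a3 a4 a5 a6 : R) (b1 b2 b3 b4 b5 b6 : R) x u v w z :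
  let ch := chform b1 b2 b3 b4 b5 b6 x v w in
  chform a1 a2 a3 a4 a5 a6 x u (chvec b1 b2 b3 b4 b5 b6 x v w) z =
  a1 * (edot x u * ch z + ch x * edot u z)
  + a2 * ch u * edot x z
  + a3 * edot x u * ch x * edot x z
  + a4 * (edot x u * ch (J x) + ch x * edot (J x) u) * edot (J x) z
  + a5 * edot (J x) u * ch (J x) * edot x z
  + a6 * (ch (J x) * edot (J u) z - edot (J x) u * ch (J z)).
Proof.
rewrite /= /chform; set V := chvec _ _ _ _ _ _ _ _ _.
rewrite (edotC x V) (edotC u V) (edotC (J x) V) (Jrot_skew n_odd V) !edot_chvec.
rewrite /chform; ring.
Qed.

Definition num_coef1 (t : R) : R := pr P t - (2 * ch1 t + t * ch1 t ^+ 2) * pre P t.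
Definition num_coef5 (t : R) : R := (prq P t - pr P t * ch1 t) * (1 + t * ch1 t).
Definition num_coef6 (t : R) : R :=
  pre P t ^+ 2 * num_coef5 t - pr P t * (1 + pre P t) * num_coef1 t.
Definition num_coef3 (t : R) : R :=
  let d := pr P t in let q := prq P t in let a := ch1 t in
  2 * pre P t * (dprq P t - t * q ^+ 2) + d ^+ 2 * (t * a ^+ 2 + 2 * a)
  - t * a * d ^+ 2 * (t * q + d) + 3 * d ^+ 3 + 5 * t * d ^+ 2 * q - 6 * d * q.

(** With [pr1E] and [pr2E], derivatives of [pr] are traded for [prq] and [dprq], which can then be
    treated as independent unknowns. *)
Lemma pr1E t : pre P t != 0 -> pr1 P t = prq P t * pre P t - pr P t ^+ 2.
Proof. by move=> e0; rewrite /prq; field. Qed.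

Lemma pr2E t : pre P t != 0 ->
  pr2 P t = dprq P t * pre P t + prq P t * dpre P t - 2 * pr P t * pr1 P t.
Proof. by move=> e0; rewrite /dprq /prq; field. Qed.

(** Quadratic and linear invariants of the bivector of [X] and [Y]: [area2] is its squared norm,
    [xarea] its value on the plane of [x] and [J x], and [wedge2], fed with the pairings of [x] (or
    [J x]) with [X] and [Y], the squared norm of its contraction with that vector. *)
Definition area2 X Y : R := edot X X * edot Y Y - edot X Y ^+ 2.
Definition xarea x X Y : R := edot x X * edot (J x) Y - edot x Y * edot (J x) X.
Definition wedge2 (a b : R) X Y : R :=
  a ^+ 2 * edot Y Y - 2 * a * b * edot X Y + b ^+ 2 * edot X X.

(** A pure identity for an arbitrary polynomial [P]; the ODE enters only when the coefficients are
    evaluated in [scal_curv_formE]. *)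
Lemma rform_num x X Y : ball1 x ->
  rform P x X Y Y (gvec c P x X) =
  let t := edot x x in
  gcoef1 c t * (num_coef1 t * area2 X Y + 3 * pr P t * edot (J X) Y ^+ 2
    + num_coef3 t * xarea x X Y ^+ 2 + 6 * pr1 P t * (edot (J X) Y * xarea x X Y)
    + num_coef5 t * wedge2 (edot x X) (edot x Y) X Y
    + num_coef6 t * wedge2 (edot (J x) X) (edot (J x) Y) X Y).
Proof.
move=> bx; have e0 := ball1_pre pre_gt0 bx; have t1 := ball1_neq1 bx.
rewrite /rform /dcform /cform /cvec !chform_chvec /gvec.
rewrite /chform /dchform !(JrotD, JrotZ) !JrotK// !edotE.
rewrite !edot_JrotJ// !edot_Jrot_self// (edotC x (J x)) edot_Jrot_self//.
rewrite ?(edotC X x) ?(edotC Y x) ?(edotC Y X).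
rewrite ?(edotC x (J X)) ?(edotC x (J Y)) ?(edotC X (J x)) ?(edotC Y (J x)).
rewrite ?(edotC X (J X)) ?(edotC Y (J Y)) ?(edotC X (J Y)) ?(edotC Y (J X)).
rewrite ?(edot_JrotC n_odd X x) ?(edot_JrotC n_odd Y x) ?(edot_JrotC n_odd Y X).
rewrite !edot_Jrot_self//.
rewrite /= /num_coef3 /num_coef6 /num_coef5 /num_coef1 /area2 /xarea /wedge2.
rewrite /gcoef2 /gcoef3 -/(gcoef1 _ _) /ch2 /ch3 /ch4 /ch5 /ch6.
rewrite /dch2 /dch3 /dch4 /dch5 /dch6 /dch1.
rewrite pr2E// pr1E// /dpre pr1E//.
move: e0; rewrite /pre.
move: (gcoef1 c (edot x x)) => k.
move: (edot x x) (ch1 (edot x x)) (pr P (edot x x)) (prq P (edot x x)) (dprq P (edot x x)).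
move: (edot x X) (edot x Y) (edot (J x) X) (edot (J x) Y).
move: (edot X X) (edot X Y) (edot Y Y) (edot (J X) Y).
move=> XX XY YY w xX xY yX yY t a d q q' e0.
by field.
Qed.
End CurvatureNumerator.

(** * Einstein's equation *)

Section Ricci.
Context {R : realType} {n : nat}.
Variables (c : R) (P : {poly R}).
Hypothesis n_odd : odd n.
Hypothesis c_gt0 : 0 < c.
Hypothesis pre_gt0 : forall t, 0 <= t <= 1 -> 0 < pre P t.
Local Notation pt := 'rV[R]_n.+1.
Local Notation J := (@Jrot R n).
Local Notation ec := (@ecoord R n).
Local Notation N := (n.+1%:R : R).
Implicit Types (u v w x z : pt).

Lemma chform_scale (a b1 b2 b3 b4 b5 b6 : R) x u v w :
  chform (b1 * a) (b2 * a) (b3 * a) (b4 * a) (b5 * a) (b6 * a) x u v w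
  = a * chform b1 b2 b3 b4 b5 b6 x u v w.
Proof. by rewrite /chform; ring. Qed.

Lemma sum_edot_linear (f : pt -> R) u :
  (forall a v w, f (a *: v + w) = a * f v + f w) ->
  \sum_i edot u (ec i) * f (ec i) = f u.
Proof.
by move=> lin; rewrite -(sum_linear _ lin); apply: eq_bigr => i _; rewrite edot_ecoordr.
Qed.

Lemma trace_dcform14 x v w : let t := edot x x in
  \sum_i dcform P x (ec i) v w (ec i) =
  2 * chform (dch1 t) (dch2 P t) (dch3 P t) (dch4 P t) (dch5 P t) (dch6 P t) x v w x
  + ((2 * ch1 t + N * ch2 P t - 2 * ch6 P t) * edot v w
    + ((N + 2) * ch3 P t - 2 * ch4 P t) * (edot x v * edot x w)
    + (2 * ch4 P t + (N + 2) * ch5 P t) * (edot (J x) v * edot (J x) w)).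
Proof.
move=> t; rewrite /dcform big_split /= trace_dchform14//; congr (_ + _).
rewrite -(sum_edot_linear _ (fun a v' w' => chform_linear3 _ _ _ _ _ _ x a v w v' w')).
by rewrite mulr_sumr; apply: eq_bigr => i _; rewrite chform_scale mulrA.
Qed.

Lemma trace_dcform24 x z w : let t := edot x x in
  \sum_i dcform P x z (ec i) w (ec i) =
  2 * edot x z * (((N + 1) * dch1 t + dch2 P t + t * (dch3 P t + dch4 P t) + dch6 P t) * edot x w)
  + (((N + 1) * ch1 t + ch2 P t + t * (ch3 P t + ch4 P t) + ch6 P t) * edot z w
    + 2 * (ch3 P t + ch4 P t) * (edot x z * edot x w)).
Proof.
move=> t; rewrite /dcform big_split /= trace_dchform24//; congr (_ + _).
rewrite -(trace_chform n_odd (dch1 t) (dch2 P t) (dch3 P t) (dch4 P t) (dch5 P t) (dch6 P t)).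
rewrite -/t; set s := 2 * edot x z; rewrite mulr_sumr; apply: eq_bigr => i _.
by rewrite chform_scale.
Qed.

Lemma trace_chform_chvec (a1 a2 a3 a4 a5 a6 : R) x v w :
  let ch := chform a1 a2 a3 a4 a5 a6 x in
  \sum_i ch v (chvec a1 a2 a3 a4 a5 a6 x (ec i) w) (ec i) =
  a1 * (edot x v * (((N + 1) * a1 + a2 + edot x x * (a3 + a4) + a6) * edot x w) + ch v w x)
  + a2 * ch x w v + a3 * edot x v * ch x w x
  + a4 * (edot x v * ch (J x) w (J x) + edot (J x) v * ch (J x) w x)
  + a5 * edot (J x) v * ch x w (J x)
  + a6 * (ch (J v) w (J x)
     - edot (J x) v * ((a1 - a2 + edot x x * (a4 - a5) + (N + 1) * a6) * edot (J x) w)).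
Proof.
rewrite /=; set ch := chform a1 a2 a3 a4 a5 a6 x.
have S q p : \sum_i edot q (ec i) * ch (ec i) w p = ch q w p.
  by apply: (@sum_edot_linear (fun u => ch u w p)) => *; exact: chform_linear1.
rewrite -(trace_chform n_odd a1 a2 a3 a4 a5 a6 x w).
rewrite -(trace_chform_Jrot n_odd a1 a2 a3 a4 a5 a6 x w) -/ch.
set T1 := \sum_i ch (ec i) w (ec i); set T2 := \sum_i ch (ec i) w (J (ec i)).
transitivity (\sum_i (
   (a1 * edot x v) * ch (ec i) w (ec i) + a1 * (edot v (ec i) * ch (ec i) w x)
   + a2 * (edot x (ec i) * ch (ec i) w v)
   + (a3 * edot x v) * (edot x (ec i) * ch (ec i) w x)
   + ((a4 * edot x v) * (edot (J x) (ec i) * ch (ec i) w (J x))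
      + (a4 * edot (J x) v) * (edot (J x) (ec i) * ch (ec i) w x))
   + (a5 * edot (J x) v) * (edot x (ec i) * ch (ec i) w (J x))
   + (a6 * (edot (J v) (ec i) * ch (ec i) w (J x))
      + (- a6 * edot (J x) v) * ch (ec i) w (J (ec i))))).
  by apply: eq_bigr => i _; rewrite /ch chform_chvec// -/ch; ring.
rewrite !big_split /= -!mulr_sumr !S -/T1 -/T2; ring.
Qed.

Section Einstein.
Variables K tau : R.
Hypothesis K_ge0 : 0 <= K.
Hypothesis nE : n%:R = 2 * K + 1 :> R.
Hypothesis cE : c = 1 - tau.
Hypothesis ode : forall t : R,
  t * (1 - t ^+ 2) * pr1 P t + (K + 2 + 2 * K * t + K * t ^+ 2) * pr P t
  = 2 * (2 * K + 1) * tau.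
Hypothesis dode : forall t : R,
  t * (1 - t ^+ 2) * pr2 P t + (1 - 3 * t ^+ 2) * pr1 P t
  + (K + 2 + 2 * K * t + K * t ^+ 2) * pr1 P t + (2 * K + 2 * K * t) * pr P t = 0.

Lemma trace_rform x v w : ball1 x ->
  \sum_i rform P x (ec i) v w (ec i) = - n%:R * gform c P x v w.
Proof.
move=> bx; have e0 := ball1_pre pre_gt0 bx; have t1 := ball1_neq1 bx.
have NE : N = 2 * K + 2 by rewrite -natr1 nE; ring.
rewrite /rform big_split /= sumrB trace_dcform14 trace_dcform24 sumrB.
rewrite [X in _ + (X - _)]trace_chform// [X in _ + (_ - X)]trace_chform_chvec.
rewrite -/(cvec P x v w) (edotC x (cvec _ _ _ _)) edot_chvec.
rewrite /chform.
rewrite !edot_JrotJ// !JrotK// ?edotNl ?edotNr ?edot_Jrot_self//.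
rewrite ?(edotC x (J x)) ?edot_Jrot_self//.
rewrite ?(edotC v x) ?(edotC w x) ?(edotC w v).
rewrite ?(edotC v (J x)) ?(edotC w (J x)) ?(edotC x (J v)) ?(edotC x (J w)).
rewrite ?(edotC w (J v)) ?(edotC v (J w)).
rewrite ?(edot_JrotC n_odd v x) ?(edot_JrotC n_odd w x) ?(edot_JrotC n_odd w v).
rewrite /gform /= /mform /gcoef2 /gcoef3 -/(gcoef1 _ _) NE nE.
rewrite /gcoef1 cE /conf /ch2 /ch3 /ch4 /ch5 /ch6 /dch2 /dch3 /dch4 /dch5 /dch6 /dch1.
rewrite /ch1 /dprq /prq /dpre.
have t0 := edot_ge0 x.
have x0 : edot x x = 0 ->
    [/\ edot x v = 0, edot x w = 0, edot (J x) v = 0 & edot (J x) w = 0].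
  by move=> /eqP; rewrite edot_eq0 => /eqP ->; rewrite Jrot0 !edot0l.
have K0 : 0 <= K by [].
have m0 : 2 * K + 1 != 0 by rewrite gt_eqF//; lra.
(* The ODE is solved for [tau], whose coefficient [2 * (2 * K + 1)] never vanishes, and not for
   [pr1], whose coefficient is zero at the center. *)
have tauE : tau = (edot x x * (1 - edot x x ^+ 2) * pr1 P (edot x x)
   + (K + 2 + 2 * K * edot x x + K * edot x x ^+ 2) * pr P (edot x x)) / (2 * (2 * K + 1)).
  by rewrite ode; field.
have := dode (edot x x).
move: e0; rewrite {}tauE /pre.
have : edot x x < 1 := bx.
move: x0 t0 t1.
move: (edot x x) (edot x v) (edot x w) (edot v w) (edot (J x) v) (edot (J x) w) (edot (J v) w).
move=> t xv xw vw yv yw Jvw.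
move: (pr P t) (pr1 P t) (pr2 P t) => d d1 d2 x0 t0 t1 tlt1 e0 ode2.
have t1' : 1 - t != 0 by rewrite subr_eq0 eq_sym.
(* At the center the second equation cannot be solved for [d2], but there the pairings with [x] and
   [J x] vanish and take the terms in [d2] with them. *)
have [tz|tn0] := eqVneq t 0.
  have [-> -> -> ->] := x0 tz; rewrite {}tz.
  by field; rewrite m0.
have t2' : 1 + t != 0 by rewrite gt_eqF//; lra.
have -> : d2 = - ((1 - 3 * t ^+ 2) * d1 + (K + 2 + 2 * K * t + K * t ^+ 2) * d1
    + (2 * K + 2 * K * t) * d) / (t * (1 - t) * (1 + t)).
  apply: (mulfI (_ : t * (1 - t) * (1 + t) != 0)); first by rewrite !mulf_neq0.
  rewrite [RHS]mulrC divfK ?mulf_neq0//.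
  by apply/eqP; rewrite -subr_eq0 -ode2; apply/eqP; ring.
by field; rewrite m0 t1' t2' tn0 e0.
Qed.

Lemma einstein_tn_metric : einstein_ball (@tn_metric R n c P).
Proof.
move=> x bx j k; rewrite /ricci [tn_metric _ _ _ _ _]mxE.
rewrite -trace_rform//; apply: eq_bigr => i _; exact: riem_tn_metric.
Qed.

End Einstein.
End Ricci.

(** * Bounds on the curvature components *)

Section ProfileConsequences.
Context {R : realType} (k : nat).
Hypothesis k_gt0 : (0 < k)%N.
Local Notation K := (k%:R : R).
Local Notation m := (2 * K + 1).
Local Notation b t := (@profile R k).[t].
Implicit Types t : R.

(** By [(1 + t)^2 = (1 - t)^2 + 4 t] the bound becomes linear in [(1 - t)^2 b] and [t b], the two
    quantities from which the curvature components are built. The next lemmas do the same for the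
    lower bounds. *)
Lemma profile_ubM t : 0 <= t <= 1 ->
  (m + 3) * ((1 - t) ^+ 2 * b t) + 4 * m * (t * b t) <= m.
Proof.
move=> t01; have K1 : 1 <= K by rewrite ler1n.
have := profile_ub k_gt0 t01; case/andP: t01 => t0 t1.
have D : 0 < 3 * (1 - t) ^+ 2 + m * (1 + t) ^+ 2.
  have p1 : 0 < m * (1 + t) ^+ 2 by rewrite mulr_gt0 ?exprn_gt0//; lra.
  have p2 : 0 <= 3 * (1 - t) ^+ 2 by rewrite mulr_ge0 ?sqr_ge0.
  lra.
by rewrite ler_pdivlMr//; nra.
Qed.

(** The first part drops a term [4 t^2 b >= 0] from the cleared lower bound; the second is that
    bound multiplied by [1 - t]. *)
Lemma profile_lbM t : 0 <= t <= 1 ->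
  m <= (m + 3) * ((1 - t) ^+ 2 * b t) + 4 * (m + 1) * (t * b t) /\
  m * (1 - 4 * (t * b t)) * (1 - t) <= (m + 1) * ((1 - t) ^+ 2 * b t) * (1 - t)
     + 2 * (1 + t) * ((1 - t) ^+ 2 * b t).
Proof. 
move=> t01; have K1 : 1 <= K by rewrite ler1n.
have := profile_lb k_gt0 t01; case/andP: t01 => t0 t1.
have D : 0 < m * (1 + t) ^+ 2 + (1 - t) * (3 + t).
  have p1 : 0 < m * (1 + t) ^+ 2 by rewrite mulr_gt0 ?exprn_gt0//; lra.
  have p2 : 0 <= (1 - t) * (3 + t) by rewrite mulr_ge0//; lra.
  lra.
have b0 : 0 <= b t.
  apply: (le_trans _ (profile_lb k_gt0 (_ : 0 <= t <= 1))); last by rewrite t0.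
  by rewrite divr_ge0 ?(ltW D)//; lra.
rewrite ler_pdivrMr// => h; split.
  have : 0 <= b t * (t * t) by rewrite !mulr_ge0.
  nra.
rewrite -subr_ge0.
rewrite (_ : _ - _ = (1 - t) *
  (b t * (m * (1 + t) ^+ 2 + (1 - t) * (3 + t)) - m)); last by ring.
by rewrite mulr_ge0// subr_ge0.
Qed.

Lemma profile_lbM' t : 0 <= t <= 1 ->
  m * (K - 1) <= (2 * K ^+ 2 + 2 * K - 3) * ((1 - t) ^+ 2 * b t)
     + 4 * K * (2 * K - 1) * (t * b t).
Proof.
move=> t01; have K1 : 1 <= K by rewrite ler1n.
have := profile_lb' k_gt0 t01; case/andP: t01 => t0 t1.
have D : 0 < 3 * (K - 1) * (1 - t) ^+ 2 + K * (2 * K - 1) * (1 + t) ^+ 2.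
  have p1 : 0 < K * (2 * K - 1) * (1 + t) ^+ 2.
    by rewrite !mulr_gt0 ?exprn_gt0//; lra.
  have p2 : 0 <= 3 * (K - 1) * (1 - t) ^+ 2 by rewrite mulr_ge0 ?sqr_ge0//; lra.
  lra.
rewrite ler_pdivrMr// => h; apply: (le_trans h); rewrite le_eqVlt; apply/orP; left.
by apply/eqP; ring.
Qed.

Lemma profile_ge0 t : 0 <= t <= 1 -> 0 <= b t.
Proof.
move=> t01; have K1 : 1 <= K by rewrite ler1n.
apply: le_trans (profile_lb k_gt0 t01); case/andP: t01 => t0 t1.
have p1 : 0 <= m * (1 + t) ^+ 2 by rewrite mulr_ge0 ?sqr_ge0//; lra.
have p2 : 0 <= (1 - t) * (3 + t) by rewrite mulr_ge0//; lra.
by rewrite divr_ge0//; lra.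
Qed.

Lemma profile_le_quarter t : 0 <= t <= 1 -> 4 * (t * b t) <= 1.
Proof.
move=> t01; have K1 : 1 <= K by rewrite ler1n.
have X0 : 0 <= (m + 3) * ((1 - t) ^+ 2 * b t).
  by rewrite mulr_ge0 ?mulr_ge0 ?sqr_ge0 ?profile_ge0//; lra.
have m0 : 0 < m by lra.
rewrite -(ler_pM2l m0); have := profile_ubM t01; lra.
Qed.

End ProfileConsequences.

Section WeylBounds.
Context {R : realType} (k : nat).
Hypothesis k_gt0 : (0 < k)%N.
Local Notation K := (k%:R : R).
Local Notation m := (2 * K + 1).
Variable t : R.
Hypothesis t01 : 0 <= t < 1.
Local Notation X := ((1 - t) ^+ 2 * (@profile R k).[t]).
Local Notation Y := (t * (@profile R k).[t]).
Local Notation h := (1 - 4 * Y).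

(* In an orthonormal frame adapted to the radial and Hopf directions, [weyl_rad],
   [weyl_mix], [weyl_hor], [3 * X] and [weyl_cross] are the components of the
   derivative in lambda of the curvature tensor. *)
Definition weyl_rad : R := K * ((m + 1) * X - (m - 2) * h).
Definition weyl_mix : R := ((m + 1) * X - (m - 2) * h) / 2.
Definition weyl_hor : R := X - h.
Definition weyl_cross : R := 3 * (m * h - (m + 1) * X) * (1 - t) / (1 + t).
Definition weyl_form (a s hh w : R) : R :=
  weyl_rad * a ^+ 2 - weyl_mix * s + weyl_hor * hh + 3 * X * w ^+ 2 + weyl_cross * (a * w).
(** Equal to [4 * b(0) - 1], which is [weyl_hor + 3 * X] at the center. *)
Definition weyl_max : R := 3 * K / (K + 2).

(** For a plane, [a] is the radial-Hopf component of its bivector, [s] the sum of squares of the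
    mixed components, [hh] the squared norm of the horizontal part and [w] the Kaehler form on it.
    The hypothesis on [w] and [hh] is Bessel's inequality; those on [a * w] and [s] express
    decomposability and control the cross term. *)
Lemma weyl_form_bounds (a s hh w : R) :
  w ^+ 2 <= hh -> 2 * (a * w) <= s -> - (2 * (a * w)) <= s ->
  - (a ^+ 2 + s + hh) <= weyl_form a s hh w <= weyl_max * (a ^+ 2 + s + hh).
Proof.
move=> whh aws aws'.
have t01' : 0 <= t <= 1 by case/andP: t01 => -> /ltW.
have K1 : 1 <= K by rewrite ler1n.
have b1 := profile_ubM k_gt0 t01'.
have [b2 b3] := profile_lbM k_gt0 t01'.
have b4 := profile_lbM' k_gt0 t01'.
have bX : 0 <= X by rewrite mulr_ge0 ?sqr_ge0 ?profile_ge0.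
have bY : 0 <= Y by case/andP: t01 => t0 _; rewrite mulr_ge0 ?profile_ge0.
have bY1 := profile_le_quarter k_gt0 t01'.
have cE : weyl_max * (K + 2) = 3 * K by rewrite /weyl_max divfK// gt_eqF//; lra.
have cross0 : 0 <= weyl_cross.
  rewrite /weyl_cross; case/andP: t01 => t0 t1.
  by rewrite divr_ge0 ?mulr_ge0//; lra.
have crossX : weyl_cross <= 6 * X.
  case/andP: t01 => t0 t1.
  by rewrite /weyl_cross ler_pdivrMr; lra.
move: bX bY bY1 b1 b2 b4 cross0 crossX {b3}.
rewrite /weyl_form /weyl_rad /weyl_mix /weyl_hor.
move: weyl_cross weyl_max cE; move: X Y => x y g c cE x0 y0 y1 b1 b2 b4 g0 gx.
set q := ((m + 1) * x - (m - 2) * (1 - 4 * y)) / 2.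
have pE : K * ((m + 1) * x - (m - 2) * (1 - 4 * y)) = 2 * K * q by rewrite /q; field.
rewrite pE.
have Kx : 0 <= K * x by rewrite mulr_ge0.
have Ky : 0 <= K * y by rewrite mulr_ge0.
have K2 : 0 < K + 2 by lra.
have alq : x - (1 - 4 * y) + q <= 0 by rewrite /q; lra.
have pc : 2 * K * q <= c.
  rewrite -(ler_pM2l K2) [leRHS]mulrC cE.
  have K10 : 0 <= K + 1 by lra.
  have h1 := ler_wpM2l K10 b1.
  have h2 : (K + 2) * (2 * q) <= 3 by rewrite /q; lra.
  have := ler_wpM2l (ler0n R k) h2; lra.
have hc : 4 * x - (1 - 4 * y) <= c by rewrite -(ler_pM2l K2) [leRHS]mulrC cE; lra.
have gc : g <= 2 * (c + q).
  suff : 3 * x - q <= c by lra.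
  rewrite -(ler_pM2l K2) [leRHS]mulrC cE /q.
  (* After multiplication by [K + 2], the coefficient of [x] on the left is [(K + 2) * (2 - K)]. It
     is positive for [k = 1], which calls for the upper bound on b, and at most 0 from [k = 2] on,
     which calls for the lower bound. *)
  have [k1|k2] := leqP k 1.
    have k1' : k = 1%N by apply/eqP; rewrite eqn_leq k1.
    move: b1; rewrite k1'; lra.
  have k2' : 2 <= K by rewrite (ler_nat R 2).
  have k20 : 0 <= K - 2 by lra.
  have := ler_wpM2l k20 b2; lra.
have x3 : 3 * x - 2 * K * q <= 1 by rewrite /q; lra.
have q1 : q <= 1 by rewrite /q; lra.
have z0 := normr_ge0 (a * w); have zl := ler_norm (a * w); have zr := lerNnormlW (lexx `|a * w|).
have zs : 2 * `|a * w| <= s by case: (ger0P (a * w)) => _; lra.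
have zz : `|a * w| = `|a| * `|w| by rewrite normrM.
have a2 : a ^+ 2 = `|a| ^+ 2 by rewrite -normrX ger0_norm ?sqr_ge0.
have w2 : w ^+ 2 = `|w| ^+ 2 by rewrite -normrX ger0_norm ?sqr_ge0.
have sq0 : 0 <= x * (w ^+ 2 - 2 * `|a * w| + a ^+ 2).
  rewrite a2 w2 zz mulr_ge0// (_ : _ + _ = (`|w| - `|a|) ^+ 2) ?sqr_ge0//; ring.
have a0 := sqr_ge0 a; have hh0 : 0 <= hh by apply: le_trans whh; exact: sqr_ge0.
have s0 : 0 <= s by lra.
have gz : - (6 * x * `|a * w|) <= g * (a * w).
  have : g * (- `|a * w|) <= g * (a * w) by rewrite ler_wpM2l.
  have : g * `|a * w| <= 6 * x * `|a * w| by rewrite ler_wpM2r.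
  lra.
have gz' : g * (a * w) <= 2 * (c + q) * `|a * w|.
  apply: (le_trans (ler_wpM2l g0 zl)); exact: ler_wpM2r.
apply/andP; split.
(* The cross term is at least [- 6 x |a w|]; with [3 x w^2] it is completed to the square [sq0], at
   the cost of [3 x a^2], which explains the coefficient of [a ^+ 2]. *)
- have h1 : 0 <= (1 - (3 * x - 2 * K * q)) * a ^+ 2 by rewrite mulr_ge0// subr_ge0.
  have h2 : 0 <= (1 - q) * s by rewrite mulr_ge0// subr_ge0.
  have h3 : 0 <= (x + 4 * y) * hh by rewrite mulr_ge0//; lra.
  lra.
(* The four products add up to the required difference, once the cross term is replaced by its bound
   [gz']. In effect [hh - w^2] is moved from the horizontal to the mixed weight, and [s] pays for
   the cross term. *)
- have h1 : 0 <= (c - 2 * K * q) * a ^+ 2 by rewrite mulr_ge0// subr_ge0.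
  have h2 : 0 <= - (x - (1 - 4 * y) + q) * (hh - w ^+ 2).
    by rewrite mulr_ge0 ?subr_ge0// oppr_ge0.
  have h3 : 0 <= (c - (4 * x - (1 - 4 * y))) * w ^+ 2.
    by rewrite mulr_ge0 ?subr_ge0 ?sqr_ge0.
  have h4 : 0 <= (c + q) * (s + hh - w ^+ 2 - 2 * `|a * w|).
    by rewrite mulr_ge0; lra.
  lra.
Qed.
End WeylBounds.

(** * The profile for a given lambda *)

Section TaubNUTProfile.
Context {R : realType} (k : nat).
Hypothesis k_gt0 : (0 < k)%N.
Variable lam : R.
Hypothesis lam_gt0 : 0 < lam.
Local Notation K := (k%:R : R).
Local Notation m := (2 * K + 1).
Local Notation b := (@profile R k).
Implicit Types t : R.

Definition tn_tau : R := 1 - lam^-1.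
Definition tn_poly : {poly R} := (4 * tn_tau) *: b.
Local Notation tau := tn_tau.
Local Notation P := tn_poly.

Lemma pr_tn t : pr P t = 4 * tau * b.[t].
Proof. by rewrite /pr hornerZ. Qed.

Lemma pr1_tn t : pr1 P t = 4 * tau * b^`().[t].
Proof. by rewrite /pr1 derivZ hornerZ. Qed.

Lemma pr2_tn t : pr2 P t = 4 * tau * b^`()^`().[t].
Proof. by rewrite /pr2 !derivZ hornerZ. Qed.

Lemma tn_ode t :
  t * (1 - t ^+ 2) * pr1 P t + (K + 2 + 2 * K * t + K * t ^+ 2) * pr P t
  = 2 * (2 * K + 1) * tau.
Proof.
rewrite pr_tn pr1_tn; transitivity (4 * tau * ((2 * K + 1) / 2)); last by field.
by rewrite -(profile_ode k t); ring.
Qed.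

Lemma tn_dode t :
  t * (1 - t ^+ 2) * pr2 P t + (1 - 3 * t ^+ 2) * pr1 P t
  + (K + 2 + 2 * K * t + K * t ^+ 2) * pr1 P t + (2 * K + 2 * K * t) * pr P t = 0.
Proof.
rewrite pr_tn pr1_tn pr2_tn; transitivity (4 * tau * 0 : R); last by rewrite mulr0.
by rewrite -(profile_dode k t); ring.
Qed.

(** A convex combination of [lam] and 1, because [0 <= 4 * (t * b) <= 1]. This keeps [pre] positive
    for every positive [lam]. *)
Lemma lam_pre t : lam * pre P t = lam * (1 - 4 * (t * b.[t])) + 4 * (t * b.[t]).
Proof. by rewrite /pre pr_tn /tau; field; rewrite gt_eqF. Qed.

Lemma tn_pre_bounds t : 0 <= t <= 1 ->
  Num.min 1 lam <= lam * pre P t <= Num.max 1 lam.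
Proof.
move=> t01; rewrite lam_pre.
have y1 := profile_le_quarter k_gt0 t01.
have y0 : 0 <= t * b.[t].
  by case/andP: (t01) => t0 _; rewrite mulr_ge0 ?(profile_ge0 k_gt0 t01).
move: (t * b.[t]) y0 y1 => y y0 y1.
rewrite ge_min le_max.
by case: (leP 1 lam) => l1; apply/andP; split; apply/orP; [left|right|right|left]; nra.
Qed.

Lemma tn_pre_gt0 t : 0 <= t <= 1 -> 0 < pre P t.
Proof.
move=> /tn_pre_bounds /andP[h _].
have : 0 < lam * pre P t by apply: lt_le_trans h; rewrite lt_min ltr01.
by rewrite pmulr_rgt0.
Qed.

Definition scal_curv_form t (I1 w D F5 F6 : R) : R :=
  num_coef1 P t * I1 + 3 * pr P t * w ^+ 2 + num_coef3 P t * D ^+ 2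
  + 6 * pr1 P t * (w * D) + num_coef5 P t * F5 + num_coef6 P t * F6.

(** Here the affine dependence on lambda becomes visible. [a^2 + s + hh] is the squared area up to
    the conformal factor: radial-horizontal components have weight [1 / pre], Hopf-horizontal ones
    [pre], and for the radial-Hopf component the two weights cancel. *)
Lemma scal_curv_formE t (I1 w D F5 F6 : R) : 0 < t < 1 ->
  let s := (F5 - D ^+ 2 / t) / t / pre P t + pre P t * ((F6 - D ^+ 2 / t) / t) in
  let hh := I1 - F5 / t - F6 / t + D ^+ 2 / t ^+ 2 in
  let a := D / t in
  scal_curv_form t I1 w D F5 F6 =
  conf t * ((1 - tau) * (- (a ^+ 2 + s + hh)) + tau * weyl_form k t a s hh (w - D / t)).
Proof.
move=> /andP[t0 t1] s hh a.
have e0 : pre P t != 0 by rewrite gt_eqF// tn_pre_gt0// !ltW.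
have t1' : 1 - t != 0 by rewrite gt_eqF// subr_gt0.
have t2' : 1 + t != 0 by rewrite gt_eqF//; lra.
have t0' : t != 0 by rewrite gt_eqF.
have h1 := profile_ode k t; have h2 := profile_dode k t.
rewrite /scal_curv_form /num_coef6 /num_coef5 /num_coef3 /num_coef1 /dprq /prq /dpre.
rewrite /weyl_form /weyl_rad /weyl_mix /weyl_hor /weyl_cross /s /hh /a.
move: e0; rewrite /pre pr_tn pr1_tn pr2_tn /conf /ch1.
move: h1 h2; move: b.[t] b^`().[t] b^`()^`().[t] tau => d d1 d2 T h1 h2 e0.
(* For [0 < t < 1] the ODE and its derivative express both derivatives of b through b itself,
   leaving a rational identity. *)
have -> : d2 = - ((1 - 3 * t ^+ 2) * d1 + (K + 2 + 2 * K * t + K * t ^+ 2) * d1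
    + (2 * K + 2 * K * t) * d) / (t * (1 - t) * (1 + t)).
  apply: (mulfI (_ : t * (1 - t) * (1 + t) != 0)); first by rewrite !mulf_neq0.
  rewrite [RHS]mulrC divfK ?mulf_neq0//.
  by apply/eqP; rewrite -subr_eq0 -h2; apply/eqP; ring.
have -> : d1 = ((2 * K + 1) / 2 - (K + 2 + 2 * K * t + K * t ^+ 2) * d)
     / (t * (1 - t) * (1 + t)).
  apply: (mulfI (_ : t * (1 - t) * (1 + t) != 0)); first by rewrite !mulf_neq0.
  rewrite [RHS]mulrC divfK ?mulf_neq0//.
  by rewrite -h1; ring.
by field; rewrite t1' t2' t0' e0.
Qed.
End TaubNUTProfile.

(** * Horizontal projections and decomposability *)

Section HorizontalParts.
Context {R : realType} {n : nat}.
Hypothesis n_odd : odd n.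
Local Notation pt := 'rV[R]_n.+1.
Local Notation J := (@Jrot R n).
Implicit Types x X Y : pt.

Definition hpart x X : pt :=
  X - (edot x X / edot x x) *: x - (edot (J x) X / edot x x) *: J x.

Lemma edot_hpart x X Y : x != 0 -> edot (hpart x X) (hpart x Y) =
  edot X Y - (edot x X * edot x Y + edot (J x) X * edot (J x) Y) / edot x x.
Proof.
rewrite -edot_gt0 => /lt0r_neq0 t0; rewrite /hpart !edotE edot_JrotJ// (edotC x (J x)).
rewrite edot_Jrot_self// (edotC X x) (edotC X (J x)).
by field.
Qed.

Lemma edot_Jrot_hpart x X Y : x != 0 -> edot (J (hpart x X)) (hpart x Y) =
  edot (J X) Y - xarea x X Y / edot x x.
Proof.
rewrite -edot_gt0 => /lt0r_neq0 t0; rewrite /hpart /xarea !(JrotD, JrotN, JrotZ) JrotK//.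
rewrite !edotE edot_JrotJ// (edotC x (J x)) edot_Jrot_self// (edot_JrotC n_odd X x).
rewrite edot_JrotJ// (edotC X x).
by field.
Qed.

Lemma sqnorm_Jrot_sub_ge0 X Y (a : R) :
  0 <= edot X X - 2 * a * edot (J X) Y + a ^+ 2 * edot Y Y.
Proof.
have := edot_ge0 (J X - a *: Y).
rewrite !edotE edot_JrotJ// (edotC Y (J X)).
by congr (_ <= _); ring.
Qed.

Lemma sqnorm_comb X Y (a b : R) : edot (a *: X - b *: Y) (a *: X - b *: Y) =
  a ^+ 2 * edot X X - 2 * a * b * edot X Y + b ^+ 2 * edot Y Y.
Proof. by rewrite !edotE (edotC Y X); ring. Qed.

Lemma edot_Jrot_comb X Y (a b c d : R) :
  edot (J (a *: X - b *: Y)) (c *: X - d *: Y) = (b * c - a * d) * edot (J X) Y.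
Proof.
by rewrite !(JrotD, JrotN, JrotZ) !edotE !edot_Jrot_self// (edot_JrotC n_odd Y X); ring.
Qed.

Variables (e : R) (x X Y : pt).
Hypothesis e_gt0 : 0 < e.
Hypothesis x_neq0 : x != 0.
Local Notation t := (edot x x).
Local Notation D := (xarea x X Y).
Local Notation F5 := (wedge2 (edot x X) (edot x Y) X Y).
Local Notation F6 := (wedge2 (edot (J x) X) (edot (J x) Y) X Y).
Local Notation w := (edot (J X) Y - D / t).
Local Notation s := ((F5 - D ^+ 2 / t) / t / e + e * ((F6 - D ^+ 2 / t) / t)).

(** Bessel's inequality for the horizontal parts of [X] and [Y]; the right-hand side is their Gram
    determinant. *)
Lemma horizontal_area : w ^+ 2 <= area2 X Y - F5 / t - F6 / t + D ^+ 2 / t ^+ 2.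
Proof.
have t0 : t != 0 by rewrite gt_eqF// edot_gt0.
rewrite -edot_Jrot_hpart// -(lerD2l (edot (hpart x X) (hpart x Y) ^+ 2)).
apply: (le_trans (bessel_Jrot n_odd _ _)); rewrite !edot_hpart//.
rewrite le_eqVlt; apply/orP; left; apply/eqP.
by rewrite /area2 /wedge2 /xarea; field.
Qed.

(** Contracting the bivector with [x] and with [J x] and projecting gives [P0] and [P1], both in the
    span of the two horizontal parts. Hence [edot (J P0) P1] is the determinant [D] times [w], and
    the claim is [|J P0 - e r P1|^2 >= 0] divided by [e t]. *)
Let mixed_aux (r : R) : r ^+ 2 = 1 -> 2 * r * (D / t * w) <= s.
Proof.
move=> r2; have t0 : 0 < t by rewrite edot_gt0.
have tn0 : t != 0 by rewrite gt_eqF.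
have en0 : e != 0 by rewrite gt_eqF.
pose P0 := edot x X *: hpart x Y - edot x Y *: hpart x X.
pose P1 := edot (J x) X *: hpart x Y - edot (J x) Y *: hpart x X.
have := sqnorm_Jrot_sub_ge0 P0 P1 (e * r).
have -> : edot P0 P0 = F5 - D ^+ 2 / t.
  by rewrite sqnorm_comb !edot_hpart// (edotC Y X) /wedge2 /xarea; field.
have -> : edot P1 P1 = F6 - D ^+ 2 / t.
  by rewrite sqnorm_comb !edot_hpart// (edotC Y X) /wedge2 /xarea; field.
have -> : edot (J P0) P1 = D * w.
  by rewrite edot_Jrot_comb edot_Jrot_hpart// (edot_JrotC n_odd Y X) /xarea; field.
set Q := (X in 0 <= X) => Q0.
rewrite -subr_ge0; suff -> : s - 2 * r * (D / t * w) = Q / e / t.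
  by rewrite !divr_ge0// ltW.
rewrite /Q exprMn r2; field; rewrite en0 tn0//.
Qed.

Lemma mixed_area : 2 * (D / t * w) <= s.
Proof. by have := mixed_aux (expr1n _ 2); rewrite mulr1. Qed.

Lemma mixed_areaN : - (2 * (D / t * w)) <= s.
Proof.
have := @mixed_aux (- 1); rewrite sqrrN expr1n => /(_ erefl).
by rewrite mulrN1 mulNr.
Qed.
End HorizontalParts.

(** * Positive definiteness *)

Section MetricPositivity.
Context {R : realType} {n : nat}.
Variables (c : R) (P : {poly R}).
Hypothesis n_odd : odd n.
Hypothesis c_gt0 : 0 < c.
Hypothesis pre_gt0 : forall t, 0 <= t <= 1 -> 0 < pre P t.
Local Notation pt := 'rV[R]_n.+1.
Local Notation J := (@Jrot R n).
Implicit Types x u v X Y : pt.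

(** The eigenvalues of this form are 1, [1 / pre] and [pre], and the hypotheses put [mu] below each
    of them. *)
Lemma mform_pr_ge x v (mu : R) : edot x x <= 1 ->
  0 <= mu <= 1 -> mu <= pre P (edot x x) -> mu * pre P (edot x x) <= 1 ->
  mu * edot v v <= mform 1 (pr P (edot x x) / pre P (edot x x)) (- pr P (edot x x)) x v v.
Proof.
move=> x1 /andP[mu0 mu1] mue mue1.
have e0 : 0 < pre P (edot x x) by rewrite pre_gt0// edot_ge0.
have := bessel_Jrot n_odd x v; rewrite /mform -!expr2.
have [->|xn0] := eqVneq x 0.
  rewrite Jrot0 !edot0l !expr0n /= !mulr0 !addr0 mul1r => _.
  by rewrite ler_piMl ?edot_ge0.
have t0 : 0 < edot x x by rewrite edot_gt0.
have tn0 : edot x x != 0 by rewrite gt_eqF.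
have en0 := e0; move/lt0r_neq0: en0 => en0.
have dE : pr P (edot x x) = (1 - pre P (edot x x)) / edot x x by rewrite /pre; field.
rewrite dE; move: (edot x x) (pre P (edot x x)) e0 en0 mue mue1 t0 tn0 {dE x1}.
move: (edot v v) (edot x v ^+ 2) (sqr_ge0 (edot x v)) (edot (J x) v ^+ 2) (sqr_ge0 (edot (J x) v)).
move=> vv a a0 b b0 t e e0 en0 mue mue1 t0 tn0 h.
(* Horizontal, radial and Hopf parts of the excess; the first is nonnegative by Bessel's inequality
   [h]. *)
rewrite -subr_ge0 (_ : _ - _ = ((1 - mu) * (t * vv - (a + b)) + (1 - mu * e) * a / e + (e - mu) * b) / t).
  rewrite divr_ge0// ?(ltW t0)// !addr_ge0 ?mulr_ge0 ?invr_ge0 ?subr_ge0// ltW//.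
by field; rewrite en0 tn0.
Qed.

Lemma gformE x u v : gform c P x u v = gcoef1 c (edot x x) *
  mform 1 (pr P (edot x x) / pre P (edot x x)) (- pr P (edot x x)) x u v.
Proof. by rewrite /gform /= /mform /gcoef2 /gcoef3 /gcoef1; ring. Qed.

Lemma gform_gt0 x v : ball1 x -> v != 0 -> 0 < gform c P x v v.
Proof.
move=> bx v0; rewrite gformE; apply: mulr_gt0; first exact: gcoef1_gt0.
have e0 : 0 < pre P (edot x x) by apply: pre_gt0; exact: ball1_sqnorm.
pose mu := Num.min 1 (Num.min (pre P (edot x x)) (pre P (edot x x))^-1).
have mu0 : 0 < mu by rewrite !lt_min ltr01 e0 invr_gt0 e0.
apply: (@lt_le_trans _ _ (mu * edot v v)); first by rewrite mulr_gt0// edot_gt0.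
apply: mform_pr_ge.
- exact: ltW.
- by rewrite (ltW mu0) ge_min lexx.
- by rewrite !ge_min lexx orbT.
- by rewrite -ler_pdivlMr// mul1r !ge_min lexx !orbT.
Qed.

Lemma gform_ge0 x v : ball1 x -> 0 <= gform c P x v v.
Proof.
move=> bx; have [->|v0] := eqVneq v 0; last exact/ltW/gform_gt0.
by rewrite /gform /= /mform !edot0r !(mulr0, addr0).
Qed.

Lemma gform_comb x X Y (a b : R) : gform c P x (a *: X - b *: Y) (a *: X - b *: Y) =
  a ^+ 2 * gform c P x X X - 2 * a * b * gform c P x X Y + b ^+ 2 * gform c P x Y Y.
Proof. by rewrite /gform /= /mform !edotE (edotC Y X); ring. Qed.

(** For nonpositive curvature only the sign of the denominator of [sec] matters; its value is
    computed at the center alone. *)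
Lemma gram_ge0 x X Y : ball1 x ->
  0 <= gform c P x X X * gform c P x Y Y - gform c P x X Y ^+ 2.
Proof.
move=> bx; have [->|Y0] := eqVneq Y 0.
  by rewrite /gform /= /mform !edot0r !(mulr0, addr0) expr0n subr0.
have YY := gform_gt0 bx Y0.
rewrite -(pmulr_rge0 _ YY).
have := gform_ge0 (gform c P x Y Y *: X - gform c P x X Y *: Y) bx.
by rewrite gform_comb; congr (_ <= _); ring.
Qed.

Lemma gram_center X Y : gform c P 0 X X * gform c P 0 Y Y - gform c P 0 X Y ^+ 2
  = (4 * c) ^+ 2 * area2 X Y.
Proof.
rewrite /gform /mform Jrot0 !edot0l /gcoef1 /conf /area2.
by rewrite subr0 expr1n divr1 !(mulr0, addr0); ring.
Qed.

Lemma sym_tn_metric x : (tn_metric c P x)^T = tn_metric c P x :> 'M[R]_n.+1.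
Proof. by apply/matrixP => i j; rewrite !mxE /gform mformC. Qed.

End MetricPositivity.

(** * The sign of the sectional curvature *)

Section CurvatureSign.
Context {R : realType} {n k : nat}.
Hypothesis k_gt0 : (0 < k)%N.
Hypothesis n_odd : odd n.
Variable lam : R.
Hypothesis lam_gt0 : 0 < lam.
Local Notation K := (k%:R : R).
Local Notation P := (tn_poly k lam).
Local Notation g := (@tn_metric R n lam^-1 P).
Local Notation pt := 'rV[R]_n.+1.
Local Notation J := (@Jrot R n).
Implicit Types x X Y : pt.

Let c_gt0 : 0 < lam^-1. Proof. by rewrite invr_gt0. Qed.
Let pre_gt0 := tn_pre_gt0 k_gt0 lam_gt0.

Lemma sec_tn x X Y : ball1 x -> sec g x X Y =
  gcoef1 lam^-1 (edot x x) * scal_curv_form k lam (edot x x) (area2 X Y) (edot (J X) Y)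
    (xarea x X Y) (wedge2 (edot x X) (edot x Y) X Y)
    (wedge2 (edot (J x) X) (edot (J x) Y) X Y)
  / (gform lam^-1 P x X X * gform lam^-1 P x Y Y - gform lam^-1 P x X Y ^+ 2).
Proof.
move=> bx; rewrite /sec !bil_tn_metric; congr (_ / _).
by rewrite sec_num_tn_metric// rform_num.
Qed.

(** Multiplied by [lam] the quantity is [(lam - 1) * W - T]. For [lam >= 1] the upper bound on [W]
    decides; for [lam < 1] the lower bound gives at most [- lam * T], whence the different outcomes
    on the two sides of 1. *)
Lemma weyl_max_le (W T : R) : (lam - 1) * weyl_max k <= 1 -> 0 <= T ->
  - T <= W <= weyl_max k * T -> (1 - tn_tau lam) * (- T) + tn_tau lam * W <= 0.
Proof.
move=> h T0 /andP[W1 W2].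
have l0 : lam != 0 by rewrite gt_eqF.
rewrite -(pmulr_rle0 _ lam_gt0).
rewrite (_ : lam * _ = (lam - 1) * W - T); last by rewrite /tn_tau; field.
have [l1|l1] := leP 1 lam.
  have : (lam - 1) * W <= (lam - 1) * (weyl_max k * T) by rewrite ler_wpM2l// subr_ge0.
  have : (lam - 1) * weyl_max k * T <= 1 * T by rewrite ler_wpM2r.
  lra.
have : 0 <= (1 - lam) * (W + T) by rewrite mulr_ge0; lra.
have : 0 <= lam * T by rewrite mulr_ge0// ltW.
lra.
Qed.

Lemma scal_curv_form0 (I1 w : R) : scal_curv_form k lam 0 I1 w 0 0 0 =
  4 * ((1 - tn_tau lam) * (- I1) + tn_tau lam * ((profile k).[0] * I1 - I1 + 3 * (profile k).[0] * w ^+ 2)).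
Proof.
rewrite /scal_curv_form /num_coef1 pr_tn /pre /ch1 !(mul0r, mulr0, addr0, subr0, expr0n) divr1.
by ring.
Qed.

Lemma nonpos_curved_tn : (lam - 1) * weyl_max k <= 1 -> nonpos_curved g.
Proof.
move=> hl x X Y bx _; rewrite sec_tn//.
apply: mulr_le0_ge0; last by rewrite invr_ge0 gram_ge0.
rewrite pmulr_rle0; last exact: gcoef1_gt0.
(* [scal_curv_formE] divides by [t], so the center is computed directly from b(0). *)
have [x0|xn0] := eqVneq x 0.
  rewrite x0 /xarea /wedge2 Jrot0 !edot0l !(mul0r, mulr0, addr0, subr0, expr0n) /=.
  rewrite scal_curv_form0 pmulr_rle0//.
  have A0 : edot (J X) Y ^+ 2 <= area2 X Y.
    by rewrite /area2 lerBrDl; exact: bessel_Jrot.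
  have w0 := sqr_ge0 (edot (J X) Y).
  have K1 : 1 <= K by rewrite ler1n.
  have b0 : 0 <= (profile k).[0] :> R by apply: profile_ge0; rewrite ?lexx ?ler01.
  apply: weyl_max_le => //; first exact: le_trans A0.
  have I0 : 0 <= area2 X Y by exact: le_trans A0.
  have bI : 0 <= (profile k).[0] * area2 X Y by rewrite mulr_ge0.
  have bw : 0 <= (profile k).[0] * edot (J X) Y ^+ 2 by rewrite mulr_ge0.
  have bw' : (profile k).[0] * edot (J X) Y ^+ 2 <= (profile k).[0] * area2 X Y.
    by rewrite ler_wpM2l.
  have -> : weyl_max k = 4 * (profile k).[0] - 1 :> R.
    by rewrite profile0// /weyl_max; field; rewrite gt_eqF//; lra.
  apply/andP; split; lra.
have t0 : 0 < edot x x by rewrite edot_gt0.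
have e0 : 0 < pre P (edot x x) by apply: pre_gt0; exact: ball1_sqnorm.
rewrite scal_curv_formE//; last by rewrite t0.
rewrite pmulr_rle0; last exact: conf_gt0.
have h1 := horizontal_area n_odd X Y xn0.
have h2 := mixed_area n_odd X Y e0 xn0.
have h3 := mixed_areaN n_odd X Y e0 xn0.
apply: weyl_max_le => //.
  by have := sqr_ge0 (xarea x X Y / edot x x); have := sqr_ge0 (edot (J X) Y - xarea x X Y / edot x x); lra.
by apply: weyl_form_bounds => //; rewrite (ltW t0).
Qed.

Lemma sec_center X : edot X X = 1 ->
  sec g 0 X (J X) = lam * (2 * (2 * K + 1) * tn_tau lam / (K + 2) - 1).
Proof.
move=> X1; have K1 : 1 <= K by rewrite ler1n.
rewrite sec_tn; last by rewrite /ball1 /= edot0l ltr01.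
rewrite gram_center /xarea /wedge2 Jrot0 !edot0l !(mul0r, mulr0, addr0, subr0, expr0n) /=.
rewrite scal_curv_form0 profile0// /area2 !edot_JrotJ// (edotC X) edot_Jrot_self// X1.
rewrite /gcoef1 /conf subr0 expr1n divr1 /tn_tau; field.
by rewrite !gt_eqF//; lra.
Qed.

Lemma indep2_Jrot X : edot X X = 1 -> indep2 X (J X).
Proof.
move=> X1; apply/eqP; rewrite -/(row_free (col_mx X (J X))).
apply: inj_row_free => v.
rewrite -[v]hsubmxK mul_row_col => h.
have D1 (a : 'M[R]_1) (u : pt) : a *m u = a 0 0 *: u.
  by rewrite {1}[a]mx11_scalar mul_scalar_mx.
move: h; rewrite !D1 => h.
have h1 : edot (lsubmx v 0 0 *: X + rsubmx v 0 0 *: J X) X = 0 by rewrite h edot0l.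
have h2 : edot (lsubmx v 0 0 *: X + rsubmx v 0 0 *: J X) (J X) = 0 by rewrite h edot0l.
move: h1 h2; rewrite !edotE edot_JrotJ// (edotC X (J X)) edot_Jrot_self// X1.
rewrite !mulr1 !mulr0 addr0 add0r => h1 h2.
by rewrite [lsubmx v]mx11_scalar [rsubmx v]mx11_scalar h1 h2 !raddf0 row_mx0.
Qed.

End CurvatureSign.

(** * Smoothness of the metric coefficients *)

Section SmoothFunctions.
Context {R : realType} {n : nat}.
Local Notation pt := 'rV[R]_n.+1.
Local Notation J := (@Jrot R n).
Local Notation ec := (@ecoord R n).
Variable U : set pt.
Hypothesis U_open : open U.
Implicit Types (f h : pt -> R) (x : pt).

Definition C0derivable f := forall x, U x ->
  {for x, continuous f} /\ forall i, derivable f x (ec i).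

(** Regularity to finite order. The product rule creates products of new functions, so closure is
    proved by induction on the order for all functions at once, and only then transferred to the
    lists of directions in [smooth_on]. *)
Fixpoint Ck (m : nat) f : Prop :=
  C0derivable f /\ (if m is m'.+1 then forall i, Ck m' (pd i f) else True).

Lemma Ck_C0 m f : Ck m f -> C0derivable f.
Proof. by case: m => [|m] []. Qed.

Lemma CkS m f : Ck m.+1 f -> Ck m f.
Proof.
elim: m f => [|m IH] f [h1 h2]; first by [].
by split=> // i; apply: IH; exact: h2.
Qed.

Lemma near_open x (Q : pt -> Prop) : U x -> (forall y, U y -> Q y) -> \forall y \near x, Q y.
Proof.
move=> Ux UQ; have := open_nbhs_nbhs (conj U_open Ux).
exact: (@filterS _ _ _ U Q UQ).
Qed.

Lemma C0derivable_ext f h : (forall x, U x -> f x = h x) -> C0derivable f -> C0derivable h.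
Proof.
move=> fh Cf x Ux; have [cf df] := Cf x Ux.
have nfh : \forall y \near x, f y = h y by exact: near_open.
split=> [|i]; last exact: near_eq_derivable nfh (df i).
rewrite /prop_for /continuous_at -fh//; apply: cvg_trans cf.
exact: (@near_eq_cvg _ _ (nbhs x) (nbhs_filter x) _ _ nfh).
Qed.

Lemma Ck_ext m f h : (forall x, U x -> f x = h x) -> Ck m f -> Ck m h.
Proof.
elim: m f h => [|m IH] f h fh Cf; split; rewrite //.
- exact: C0derivable_ext fh (Ck_C0 Cf).
- exact: C0derivable_ext fh (Ck_C0 Cf).
- move=> i; case: Cf => _ /(_ i); apply: IH => x Ux.
  by apply: near_eq_derive; exact: near_open.
Qed.

Lemma C0derivable_cst (a : R) : C0derivable (fun=> a).
Proof. by move=> x _; split=> [|i]; [exact: cst_continuous|exact: derivable_cst]. Qed.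

Lemma Ck_cst m (a : R) : Ck m (fun=> a).
Proof.
elim: m a => [|m IH] a; split; rewrite //; try exact: C0derivable_cst.
by move=> i; apply: Ck_ext (IH 0) => x _; rewrite /pd derive_cst.
Qed.

Lemma Ck_edotl m u : Ck m (fun x => edot x u).
Proof.
have reg : C0derivable (fun x => edot x u).
  move=> x _; split=> [|i]; first exact: continuous_edotl.
  by have [] := is_derive_edotl u x (ec i).
case: m => [|m]; split=> // i.
apply: Ck_ext (Ck_cst m (edot (ec i) u)) => x _.
by rewrite /pd; have [_ ->] := is_derive_edotl u x (ec i).
Qed.

Lemma C0derivable_add f h : C0derivable f -> C0derivable h -> C0derivable (fun x => f x + h x).
Proof.
move=> Cf Ch x Ux; have [cf df] := Cf x Ux; have [ch dh] := Ch x Ux.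
by split=> [|i]; [exact: continuousD|exact: derivableD].
Qed.

Lemma Ck_add m f h : Ck m f -> Ck m h -> Ck m (fun x => f x + h x).
Proof.
elim: m f h => [|m IH] f h Cf Ch; split; rewrite //;
  try exact: C0derivable_add (Ck_C0 Cf) (Ck_C0 Ch).
move=> i; case: (Cf) => rf Cf'; case: (Ch) => rh Ch'.
apply: Ck_ext (IH _ _ (Cf' i) (Ch' i)) => x Ux.
by have [_ df] := rf x Ux; have [_ dh] := rh x Ux; rewrite /pd -deriveD.
Qed.

Lemma C0derivable_mul f h : C0derivable f -> C0derivable h -> C0derivable (fun x => f x * h x).
Proof.
move=> Cf Ch x Ux; have [cf df] := Cf x Ux; have [ch dh] := Ch x Ux.
by split=> [|i]; [exact: continuousM|exact: derivableM].
Qed.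

Lemma Ck_mul m f h : Ck m f -> Ck m h -> Ck m (fun x => f x * h x).
Proof.
elim: m f h => [|m IH] f h Cf Ch; split; rewrite //;
  try exact: C0derivable_mul (Ck_C0 Cf) (Ck_C0 Ch).
move=> i; case: (Cf) => rf Cf'; case: (Ch) => rh Ch'.
apply: Ck_ext (Ck_add (IH _ _ (CkS Cf) (Ch' i)) (IH _ _ (CkS Ch) (Cf' i))) => x Ux.
have [_ df] := rf x Ux; have [_ dh] := rh x Ux.
by rewrite /pd -[RHS]/('D_(ec i) (f * h) x) deriveM.
Qed.

Lemma Ck_opp m f : Ck m f -> Ck m (fun x => - f x).
Proof.
by move=> Cf; apply: Ck_ext (Ck_mul (Ck_cst m (- 1)) Cf) => x _; rewrite mulN1r.
Qed.

Lemma C0derivable_inv f : (forall x, U x -> f x != 0) -> C0derivable f ->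
  C0derivable (fun x => (f x)^-1).
Proof.
move=> f0 Cf x Ux; have [cf df] := Cf x Ux.
by split=> [|i]; [apply: continuousV => //; exact: f0|apply: derivableV => //; exact: f0].
Qed.

(** The derivative [- f^-2 * f'] contains [f^-1] again, but one order of regularity lower, so the
    induction closes. *)
Lemma Ck_inv m f : (forall x, U x -> f x != 0) -> Ck m f -> Ck m (fun x => (f x)^-1).
Proof.
move=> f0; elim: m => [|m IH] Cf; split; rewrite //;
  try exact: C0derivable_inv f0 (Ck_C0 Cf).
move=> i; case: (Cf) => rf Cf'; have V := IH (CkS Cf).
apply: Ck_ext (Ck_opp (Ck_mul (Ck_mul V V) (Cf' i))) => x Ux.
have [_ df] := rf x Ux.
rewrite /pd deriveV//; last exact: f0.
by rewrite /GRing.scale /= mulNr expr2 invfM.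
Qed.

Lemma Ck_edot_Jrot m u : odd n -> Ck m (fun x => edot (J x) u).
Proof.
move=> n_odd; apply: Ck_ext (Ck_opp (Ck_edotl m (J u))) => x _.
by rewrite Jrot_skew.
Qed.

Lemma Ck_sqnorm m : Ck m (fun x => edot x x).
Proof.
have reg : C0derivable (fun x => edot x x).
  move=> x _; split=> [|i]; first exact: continuous_sqnorm.
  by have [] := is_derive_sqnorm x (ec i).
case: m => [|m]; split=> // i.
apply: Ck_ext (Ck_mul (Ck_cst m 2) (Ck_edotl m (ec i))) => x _.
by rewrite /pd; have [_ ->] := is_derive_sqnorm x (ec i).
Qed.

Lemma Ck_horner m (p : {poly R}) f : Ck m f -> Ck m (fun x => p.[f x]).
Proof.
move=> Cf; elim/poly_ind: p => [|p a IH].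
  by apply: Ck_ext (Ck_cst m 0) => x _; rewrite horner0.
by apply: Ck_ext (Ck_add (Ck_mul IH Cf) (Ck_cst m a)) => x _; rewrite !hornerE.
Qed.

Lemma Ck_smooth_on f : (forall m, Ck m f) -> smooth_on U f.
Proof.
move=> Cf l; suff : forall m, Ck m (iterpd l f) by move=> h; exact: (Ck_C0 (h 0%N)).
elim: l => [//|i l IH] m /=.
by have [_] := IH m.+1; apply.
Qed.

End SmoothFunctions.

Section SmoothMetric.
Context {R : realType} {n : nat}.
Variables (c : R) (P : {poly R}).
Hypothesis n_odd : odd n.
Hypothesis c_gt0 : 0 < c.
Hypothesis pre_gt0 : forall t, 0 <= t <= 1 -> 0 < pre P t.
Local Notation pt := 'rV[R]_n.+1.

Lemma riem_metric_tn : riem_metric (@ball1 R n) (tn_metric c P).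
Proof.
split=> [i j|x bx]; last first.
  by split=> [|v v0]; [exact: sym_tn_metric|rewrite bil_tn_metric; exact: gform_gt0].
apply: Ck_smooth_on => m; have O := @open_ball1 R n.
have T := Ck_sqnorm O m; have D := Ck_horner O P T.
have cst a := Ck_cst O m a.
have E : Ck (@ball1 R n) m (fun x => (pre P (edot x x))^-1).
  apply: (Ck_inv O) => [x bx|]; first exact: ball1_pre.
  exact: (Ck_add O (cst 1) (Ck_opp O (Ck_mul O T D))).
have C : Ck (@ball1 R n) m (fun x => gcoef1 c (edot x x)).
  have V : Ck (@ball1 R n) m (fun x => (1 - edot x x)^-1).
    apply: (Ck_inv O) => [x bx|]; first by rewrite subr_eq0 eq_sym ball1_neq1.
    exact: (Ck_add O (cst 1) (Ck_opp O T)).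
  apply: (Ck_ext O) (Ck_mul O (cst (c * 4)) (Ck_mul O V V)) => // x _.
  by rewrite /gcoef1 /conf expr2 invfM; ring.
have X u := Ck_edotl O m u; have Y u := Ck_edot_Jrot O m u n_odd.
apply: (Ck_ext O) (Ck_add O (Ck_add O (Ck_mul O C (cst (edot (ecoord R i) (ecoord R j))))
  (Ck_mul O (Ck_mul O C (Ck_mul O D E)) (Ck_mul O (X (ecoord R i)) (X (ecoord R j)))))
  (Ck_mul O (Ck_opp O (Ck_mul O C D)) (Ck_mul O (Y (ecoord R i)) (Y (ecoord R j))))) => // x _.
by rewrite mxE.
Qed.

End SmoothMetric.

(** * Curve length and completeness *)

Section MatrixContinuity.
Context {R : realType}.

Lemma cvg_mx {T : Type} {F : set_system T} {FF : Filter F} {m n : nat}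
    (f : T -> 'M[R]_(m, n)) (l : 'M[R]_(m, n)) :
  (forall i j, (fun t => f t i j) @ F --> l i j) -> f @ F --> l.
Proof.
move=> h; apply/cvgrPdist_le => /= e e0; near=> t.
rewrite /Num.Def.normr/= mx_normrE (bigmax_le _ (ltW e0))//= => i _.
rewrite !mxE; move: i; near: t; apply: filter_forall => /= i.
exact: (cvgrPdist_le _ _).1 (h i.1 i.2) e e0.
Unshelve. all: by end_near. Qed.

Lemma cvg_mx_coord {T : Type} {F : set_system T} {FF : Filter F} {m n : nat}
    (f : T -> 'M[R]_(m, n)) (l : 'M[R]_(m, n)) i j :
  f @ F --> l -> (fun t => f t i j) @ F --> l i j.
Proof.
move=> h; apply: (@cvg_comp _ _ _ f (fun M : 'M[R]_(m, n) => M i j) F (nbhs l)) => //.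
exact: coord_continuous.
Qed.

Lemma cvg_edot {n} {T : Type} {F : set_system T} {FF : Filter F}
    (a b : T -> 'rV[R]_n.+1) (p q : 'rV[R]_n.+1) :
  a @ F --> p -> b @ F --> q -> (fun t => edot (a t) (b t)) @ F --> edot p q.
Proof.
move=> ap bq; rewrite /edot; elim: (index_enum _) => [|i r IH].
  by under eq_fun do rewrite big_nil; rewrite big_nil; exact: cvg_cst.
under eq_fun do rewrite big_cons; rewrite big_cons.
by apply: cvgD IH; apply: cvgM; exact: cvg_mx_coord.
Qed.

Lemma cvg_Jrot {n} {T : Type} {F : set_system T} {FF : Filter F}
    (a : T -> 'rV[R]_n.+1) (p : 'rV[R]_n.+1) :
  a @ F --> p -> (fun t => Jrot (a t)) @ F --> Jrot p.
Proof.
move=> ap; apply: cvg_mx => i j; rewrite mxE.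
under eq_fun do rewrite mxE.
by case: (odd j); [|apply: cvgN]; exact: cvg_mx_coord.
Qed.

End MatrixContinuity.

Section CurveLength.
Context {R : realType}.
Local Notation mu := (@lebesgue_measure R).

Lemma increment_le_Rintegral (h dh s : R -> R) :
  (forall t : R, 0 <= t <= 1 -> is_derive t 1 h (dh t)) ->
  {within `[0, 1], continuous dh} -> {within `[0, 1], continuous s} ->
  (forall t : R, 0 <= t <= 1 -> `|dh t| <= s t) ->
  `|h 1 - h 0| <= \int[mu]_(t in `[0, 1]) s t.
Proof.
move=> hdh cdh cs dhs.
have ch : {within `[0, 1], continuous h}.
  apply: derivable_within_continuous => t; rewrite in_itv/= => t01.
  by have [] := hdh _ t01.
have idh := continuous_compact_integrable (@segment_compact _ 0 1) cdh.
have is' := continuous_compact_integrable (@segment_compact _ 0 1) cs.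
have -> : h 1 - h 0 = \int[mu]_(t in `[0, 1]) dh t.
  rewrite /Rintegral (@continuous_FTC2 _ dh h)//.
    have [_ c1 c2] := (continuous_within_itvP h ltr01).1 ch.
    split=> // t; rewrite in_itv/= => /andP[t0 t1].
    have t01 : 0 <= t <= 1 by rewrite !ltW.
    by have [] := hdh _ t01.
  move=> t; rewrite in_itv/= => /andP[t0 t1].
  have t01 : 0 <= t <= 1 by rewrite !ltW.
  by rewrite derive1E; have [_ ->] := hdh _ t01.
apply: (le_trans (le_normr_Rintegral _ idh)) => //.
by apply: le_Rintegral => //; exact: (integrable_abse idh).
Qed.

End CurveLength.

Section CurveCalculus.
Context {R : realType} {n : nat}.
Local Notation pt := 'rV[R]_n.+1.

Lemma is_derive_coord (a : R -> pt) (t : R) i : derivable a t 1 ->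
  is_derive t 1 (fun s => a s 0 i) ('D_1 a t 0 i).
Proof.
move=> da; rewrite derive_mx// mxE; apply: derivableP.
exact: ((derivable_mxP _ _ _).1 da).
Qed.

Lemma is_derive_sqnorm_curve (a : R -> pt) (t : R) : derivable a t 1 ->
  is_derive t 1 (fun s => edot (a s) (a s)) (2 * edot (a t) ('D_1 a t)).
Proof.
move=> da; rewrite /edot mulr_sumr; elim: (index_enum _) => [|i r IH].
  under eq_fun do rewrite big_nil; rewrite big_nil; exact: is_derive_const.
under eq_fun do rewrite big_cons; rewrite big_cons.
have di := is_derive_coord i da.
refine (is_derive_eq (is_derive_add (is_derive_mul di di) IH) _).
by ring.
Qed.

Lemma derive1_line (p q : pt) (t : R) :
  derivable (fun s : R => p + s *: (q - p)) t 1 /\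
  derive1 (fun s : R => p + s *: (q - p)) t = q - p.
Proof.
have h i : is_derive t 1 (fun s : R => (p + s *: (q - p)) 0 i) ((q - p) 0 i).
  under eq_fun do rewrite !mxE.
  rewrite !mxE.
  refine (is_derive_eq (is_derive_add (is_derive_const _ _ _)
    (is_derive_mul (is_derive_id _ _) (is_derive_const _ _ _))) _).
  by ring.
have d : derivable (fun s : R => p + s *: (q - p)) t 1.
  by apply/derivable_mxP => i j; rewrite ord1; have [] := h j.
split=> //; rewrite derive1E derive_mx//; apply/matrixP => i j.
by rewrite mxE ord1; have [_ ->] := h j.
Qed.

Lemma C1curve_line (p q : pt) : C1curve (fun t : R => p + t *: (q - p)).
Proof.
split=> [t _|]; first by have [] := derive1_line p q t.
rewrite (_ : derive1 _ = fun=> q - p); first by move=> ?; exact: cvg_cst.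
by apply/funext => t; have [] := derive1_line p q t.
Qed.

Lemma ball1_line (p q : pt) (t : R) : ball1 p -> ball1 q -> 0 <= t <= 1 ->
  ball1 (p + t *: (q - p)).
Proof.
rewrite /ball1 /= => hp hq /andP[t0 t1].
have h := edot_ge0 (q - p).
have a : 0 <= t * (1 - t) by rewrite mulr_ge0// subr_ge0.
have b := mulr_ge0 a h.
have -> : edot (p + t *: (q - p)) (p + t *: (q - p))
  = (1 - t) * edot p p + t * edot q q - t * (1 - t) * edot (q - p) (q - p).
  by rewrite !edotE (edotC q p); ring.
have [->|tn0] := eqVneq t 0; first by rewrite subr0 !mul0r addr0 mul1r subr0.
have tp : 0 < t by rewrite lt_neqAle eq_sym tn0.
have : t * edot q q < t * 1 by rewrite ltr_pM2l.
have : (1 - t) * edot p p <= (1 - t) * 1 by rewrite ler_wpM2l ?subr_ge0// ltW.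
lra.
Qed.

Lemma gdist_ge (g : pt -> 'M[R]_n.+1) (C : R) p q : ball1 p -> ball1 q ->
  (forall a : R -> pt, C1curve a -> (forall t, 0 <= t <= 1 -> ball1 (a t)) ->
     a 0 = p -> a 1 = q -> C <= glength g a) -> C <= gdist g p q.
Proof.
move=> bp bq h; apply: lb_le_inf.
  (* [inf] has a default value on the empty set, so a lower bound requires an admissible curve: the
     segment, which stays in the ball by convexity. *)
  exists (glength g (fun t : R => p + t *: (q - p))), (fun t : R => p + t *: (q - p)).
  split; [exact: C1curve_line|by move=> t; exact: ball1_line|..] => //.
    by rewrite scale0r addr0.
  by rewrite scale1r addrC subrK.
by move=> L [a [ca ba a0 a1 ->]]; exact: h.
Qed.

End CurveCalculus.

Section Completeness.
Context {R : realType} {n : nat}.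
Variables (c : R) (P : {poly R}).
Hypothesis n_odd : odd n.
Hypothesis c_gt0 : 0 < c.
Hypothesis pre_gt0 : forall t, 0 <= t <= 1 -> 0 < pre P t.
Variable mu : R.
Hypothesis mu_gt0 : 0 < mu.
Hypothesis mu_le1 : mu <= 1.
Hypothesis mu_pre : forall t, 0 <= t <= 1 -> mu <= pre P t /\ mu * pre P t <= 1.
Local Notation pt := 'rV[R]_n.+1.
Local Notation J := (@Jrot R n).
Local Notation g := (@tn_metric R n c P).

Lemma cvg_gform {T : Type} {F : set_system T} {FF : Filter F} (a b : T -> pt) (p q : pt) :
  a @ F --> p -> b @ F --> q -> ball1 p ->
  (fun t => gform c P (a t) (b t) (b t)) @ F --> gform c P p q q.
Proof.
move=> ap bq bp.
have aa : (fun t => edot (a t) (a t)) @ F --> edot p p by exact: cvg_edot.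
have ab : (fun t => edot (a t) (b t)) @ F --> edot p q by exact: cvg_edot.
have bb : (fun t => edot (b t) (b t)) @ F --> edot q q by exact: cvg_edot.
have Jb : (fun t => edot (J (a t)) (b t)) @ F --> edot (J p) q.
  by apply: cvg_edot => //; exact: cvg_Jrot.
have dd : (fun t => pr P (edot (a t) (a t)) : R) @ F --> (pr P (edot p p) : R).
  apply: (@cvg_comp _ _ _ (fun t => edot (a t) (a t)) (pr P) F (nbhs (edot p p))).
    exact: aa.
  exact: continuous_horner.
have e0 := ball1_pre pre_gt0 bp.
have ee : (fun t => (pre P (edot (a t) (a t)))^-1 : R) @ F --> ((pre P (edot p p))^-1 : R).
  apply: cvgV => //; rewrite /pre; apply: cvgB; first exact: cvg_cst.
  exact: (cvgM aa dd).
have kk : (fun t => gcoef1 c (edot (a t) (a t)) : R) @ F --> (gcoef1 c (edot p p) : R).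
  rewrite /gcoef1 /conf; apply: cvgM; first exact: cvg_cst.
  apply: cvgM; first exact: cvg_cst.
  apply: cvgV; first by rewrite sqrf_eq0 subr_eq0 eq_sym ball1_neq1.
  under eq_fun do rewrite expr2; rewrite expr2.
  by apply: cvgM; (apply: cvgB; [exact: cvg_cst|exact: aa]).
rewrite /gform /mform /gcoef2 /gcoef3; apply: cvgD; first apply: cvgD.
- exact: (cvgM kk bb).
- exact: (cvgM (cvgM kk (cvgM dd ee)) (cvgM ab ab)).
- exact: (cvgM (cvgN (cvgM kk dd)) (cvgM Jb Jb)).
Qed.

(** The metric dominates [c * mu] times the Poincare metric of the ball, and completeness is
    inherited from the latter. *)
Lemma gform_lower (x v : pt) : ball1 x ->
  4 * c * mu * edot v v / (1 - edot x x) ^+ 2 <= gform c P x v v.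
Proof.
move=> bx; have x1 := ball1_sqnorm bx; have [m1 m2] := mu_pre x1.
have k0 := gcoef1_gt0 c_gt0 bx.
rewrite gformE; have := mform_pr_ge n_odd pre_gt0 v (_ : edot x x <= 1) _ m1 m2.
case/andP: (x1) => _ x1'; rewrite (ltW mu_gt0) mu_le1 => /(_ x1' isT) h.
have := ler_wpM2l (ltW k0) h; apply: le_trans.
by rewrite /gcoef1 /conf le_eqVlt; apply/orP; left; apply/eqP; ring.
Qed.

Section Curve.
Variable a : R -> pt.
Hypothesis a_C1 : C1curve a.
Hypothesis a_ball : forall t, 0 <= t <= 1 -> ball1 (a t).
Local Notation v := (derive1 a).
Local Notation I01 := (`[0, 1]%classic : set R).

Lemma cvg_curve t : I01 t -> a @ within I01 (nbhs t) --> a t.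
Proof.
rewrite /= in_itv/= => t01; apply: cvg_within_filter.
have /derivable1_diffP := a_C1.1 t t01.
exact: differentiable_continuous.
Qed.

Lemma cvg_velocity t : I01 t -> v @ within I01 (nbhs t) --> v t.
Proof. by move=> It; exact: ((subspace_continuousP _ _).1 a_C1.2 t It). Qed.

Lemma continuous_speed : {within I01, continuous
  (fun t => Num.sqrt (bil (g (a t)) (v t) (v t)))}.
Proof.
rewrite (_ : (fun _ => _) = fun t => Num.sqrt (gform c P (a t) (v t) (v t))); last first.
  by apply/funext => t; rewrite bil_tn_metric.
apply/subspace_continuousP => t It.
have bt : ball1 (a t) by apply: a_ball; move: It; rewrite /= in_itv.
have cg := cvg_gform (cvg_curve It) (cvg_velocity It) bt.
apply: (@cvg_comp _ _ _ (fun s => gform c P (a s) (v s) (v s)) (@Num.sqrt R)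
  (within I01 (nbhs t)) (nbhs (gform c P (a t) (v t) (v t)))).
  exact: cg.
exact: sqrt_continuous.
Qed.

Local Notation kap := (Num.sqrt (4 * c * mu)).

Lemma kap_gt0 : 0 < kap.
Proof. by rewrite sqrtr_gt0 !mulr_gt0. Qed.

Lemma speed_lower t : 0 <= t <= 1 ->
  Num.sqrt (edot (v t) (v t)) / (1 - edot (a t) (a t)) <=
  kap^-1 * Num.sqrt (bil (g (a t)) (v t) (v t)).
Proof.
move=> t01; have bt := a_ball t01.
have x1 : 0 < 1 - edot (a t) (a t) by rewrite subr_gt0.
rewrite ler_pdivlMl ?kap_gt0// bil_tn_metric.
have -> : kap * (Num.sqrt (edot (v t) (v t)) / (1 - edot (a t) (a t))) =
   Num.sqrt (4 * c * mu * edot (v t) (v t) / (1 - edot (a t) (a t)) ^+ 2).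
  rewrite sqrtrM ?sqrtrM ?mulr_ge0 ?edot_ge0 ?(ltW c_gt0) ?(ltW mu_gt0)//.
  by rewrite sqrtrV ?sqr_ge0// sqrtr_sqr gtr0_norm// mulrA.
by rewrite ler_wsqrtr// gform_lower.
Qed.

Lemma increment_le_glength (h dh : R -> R) :
  (forall t : R, 0 <= t <= 1 -> is_derive t 1 h (dh t)) ->
  {within I01, continuous dh} ->
  (forall t : R, 0 <= t <= 1 ->
    `|dh t| <= 2 * (Num.sqrt (edot (v t) (v t)) / (1 - edot (a t) (a t)))) ->
  `|h 1 - h 0| <= 2 / kap * glength g a.
Proof.
move=> hd cd hb; have cs := continuous_speed.
rewrite /glength -RintegralZl//; last first.
  by apply: continuous_compact_integrable => //; exact: segment_compact.
apply: (@increment_le_Rintegral _ h dh) => //.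
  apply/subspace_continuousP => t It; apply: cvgM; first exact: cvg_cst.
  exact: ((subspace_continuousP _ _).1 cs t It).
move=> t t01; apply: (le_trans (hb t t01)); rewrite -[leRHS]mulrA ler_pM2l//.
exact: speed_lower.
Qed.

(** Makes Cauchy sequences of the metric Cauchy in the Euclidean sense: Euclidean speed is at most
    [|v| / (1 - |a|^2)] inside the ball. *)
Lemma coord_increment i : `|(a 1) 0 i - (a 0) 0 i| <= 2 / kap * glength g a.
Proof.
apply: (increment_le_glength (h := fun t => (a t) 0 i) (dh := fun t => v t 0 i)).
- by move=> t t01; rewrite derive1E; apply: is_derive_coord; exact: a_C1.1.
- by apply/subspace_continuousP => t It; exact: cvg_mx_coord (cvg_velocity It).
move=> t t01; have bt := a_ball t01.
have x1 : 0 < 1 - edot (a t) (a t) by rewrite subr_gt0.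
have x2 : 1 - edot (a t) (a t) <= 1 by rewrite gerBl edot_ge0.
have vi : `|v t 0 i| <= Num.sqrt (edot (v t) (v t)).
  rewrite -sqrtr_sqr ler_wsqrtr// /edot (bigD1 i)//= expr2 lerDl.
  by apply: sumr_ge0 => j _; rewrite -expr2 sqr_ge0.
have s0 := sqrtr_ge0 (edot (v t) (v t)).
rewrite mulrA ler_pdivlMr//; nra.
Qed.

(** Keeps limits off the sphere: [- ln (1 - |x|^2)] tends to infinity at the boundary while its
    gradient stays bounded in the metric. *)
Lemma log_increment :
  `|- ln (1 - edot (a 1) (a 1)) - - ln (1 - edot (a 0) (a 0))| <= 2 / kap * glength g a.
Proof.
pose dh (t : R) := 2 * edot (a t) (v t) / (1 - edot (a t) (a t)).
apply: (increment_le_glength (h := fun t => - ln (1 - edot (a t) (a t))) (dh := dh)).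
- move=> t t01; have x1 : 0 < 1 - edot (a t) (a t) by rewrite subr_gt0; exact: a_ball.
  have d1 := is_derive_sqnorm_curve (a_C1.1 t t01).
  have d2 : is_derive t 1 (fun s => 1 - edot (a s) (a s)) (- (2 * edot (a t) ('D_1 a t))).
    refine (is_derive_eq (is_derive_add (is_derive_const 1 _ _) (is_derive_opp d1)) _).
    by rewrite add0r.
  refine (is_derive_eq (is_derive_opp (@is_derive_compR _ _ (@ln R)
    (fun s => 1 - edot (a s) (a s)) t 1 _ _ (is_derive1_ln x1) d2)) _).
  by rewrite /dh derive1E; ring.
- apply/subspace_continuousP => t It; have ac := cvg_curve It; have vc := cvg_velocity It.
  have x1 : 0 < 1 - edot (a t) (a t).
    by rewrite subr_gt0; apply: a_ball; move: It; rewrite /= in_itv.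
  apply: cvgM; first by apply: cvgM; [exact: cvg_cst|exact: cvg_edot].
  apply: cvgV; first by rewrite gt_eqF.
  by apply: cvgB; [exact: cvg_cst|exact: cvg_edot].
move=> t t01; have bt := a_ball t01.
have x1 : 0 < 1 - edot (a t) (a t) by rewrite subr_gt0.
rewrite /dh -mulrA !normrM normfV (gtr0_norm x1) ger0_norm// ler_pM2l// ler_pM2r ?invr_gt0//.
rewrite -sqrtr_sqr ler_wsqrtr//; apply: (le_trans (edot_cauchy _ _)).
by rewrite ler_piMl ?edot_ge0// ltW.
Qed.

End Curve.
End Completeness.

Section CompletenessTheorem.
Context {R : realType} {n : nat}.
Variables (c : R) (P : {poly R}).
Hypothesis n_odd : odd n.
Hypothesis c_gt0 : 0 < c.
Hypothesis pre_gt0 : forall t, 0 <= t <= 1 -> 0 < pre P t.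
Variable mu : R.
Hypothesis mu_gt0 : 0 < mu.
Hypothesis mu_le1 : mu <= 1.
Hypothesis mu_pre : forall t, 0 <= t <= 1 -> mu <= pre P t /\ mu * pre P t <= 1.
Local Notation pt := 'rV[R]_n.+1.
Local Notation g := (@tn_metric R n c P).
Local Notation C := (2 / Num.sqrt (4 * c * mu)).
Implicit Types p q : pt.

Let C_gt0 : 0 < C.
Proof. by rewrite divr_gt0// kap_gt0. Qed.

Lemma coord_gdist p q i : ball1 p -> ball1 q -> `|q 0 i - p 0 i| <= C * gdist g p q.
Proof.
move=> bp bq; have C0 := C_gt0; rewrite mulrC -ler_pdivrMr//.
apply: gdist_ge => // a ca ba a0 a1; rewrite ler_pdivrMr// mulrC -a0 -a1.
exact: coord_increment.
Qed.

Lemma log_gdist p q : ball1 p -> ball1 q ->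
  `|- ln (1 - edot q q) - - ln (1 - edot p p)| <= C * gdist g p q.
Proof.
move=> bp bq; have C0 := C_gt0; rewrite mulrC -ler_pdivrMr//.
apply: gdist_ge => // a ca ba a0 a1; rewrite ler_pdivrMr// mulrC -a0 -a1.
exact: log_increment.
Qed.

Lemma complete_tn_metric : complete_ball g.
Proof.
move=> u bu Hu; have C0 := C_gt0.
have uc : cvg (u @ \oo).
  apply/cauchy_cvgP; apply: cauchy_exP => e e0.
  (* Bounding the maximum of the coordinates gives a weak inequality only, hence half of [e]. *)
  have [|M HM] := Hu (e / 2 / C); first by apply: divr_gt0 => //; exact: divr_gt0.
  exists (u M); exists M => // m /= Mm.
  rewrite -ball_normE /=; apply: (@le_lt_trans _ _ (e / 2)); last by lra.
  have e20 : 0 <= e / 2 by rewrite divr_ge0// ltW.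
  rewrite /Num.Def.normr/= mx_normrE (bigmax_le _ e20)//= => -[i j] _ /=.
  rewrite !mxE ord1.
  apply: (le_trans (coord_gdist _ (bu m) (bu M))).
  by rewrite mulrC -ler_pdivlMr// ltW// HM.
exists (lim (u @ \oo)); last exact: uc.
have tc : (fun m => edot (u m) (u m)) @ \oo --> edot (lim (u @ \oo)) (lim (u @ \oo)).
  by apply: cvg_edot; exact: uc.
(* Radius [C^-1] makes the logarithm vary by at most 1 beyond [M]. Hence [|u m|^2 <= 1 - expR (- L)]
   there, and the limit obeys the same strict separation from 1. *)
have [|M HM] := Hu C^-1; first by rewrite invr_gt0.
pose L := 1 - ln (1 - edot (u M) (u M)).
rewrite /ball1 /=; apply: (@le_lt_trans _ _ (1 - expR (- L))); last first.
  by rewrite ltrBlDr ltrDl expR_gt0.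
apply: (ler_cvg_to tc (cvg_cst _)); exists M => // m /= Mm.
have x1 : 0 < 1 - edot (u m) (u m) by rewrite subr_gt0; exact: bu.
have : `|- ln (1 - edot (u m) (u m)) - - ln (1 - edot (u M) (u M))| <= 1.
  apply: (le_trans (log_gdist (bu M) (bu m))).
  by rewrite mulrC -ler_pdivlMr// div1r ltW// HM.
rewrite ler_norml => /andP[_ h].
have hl : - L <= ln (1 - edot (u m) (u m)) by rewrite /L; lra.
have : expR (- L) <= 1 - edot (u m) (u m).
  by rewrite -(@lnK _ (1 - edot (u m) (u m))) ?ler_expR// posrE.
lra.
Qed.

End CompletenessTheorem.

(** * Conformal compactification and infinity *)

Section ConformalBoundary.
Context {R : realType} {n k : nat}.
Hypothesis k_gt0 : (0 < k)%N.
Hypothesis nE : n = (2 * k + 1)%N.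
Variable lam : R.
Hypothesis lam_gt0 : 0 < lam.
Local Notation K := (k%:R : R).
Local Notation c := (lam^-1).
Local Notation P := (tn_poly k lam).
Local Notation g := (@tn_metric R n c P).
Local Notation pt := 'rV[R]_n.+1.
Local Notation J := (@Jrot R n).
Local Notation ec := (@ecoord R n).

Definition tn_defining (x : pt) : R := 1 - edot x x.

Definition bar_form (x u v : pt) : R := 4 * c *
  mform 1 (pr P (edot x x) / pre P (edot x x)) (- pr P (edot x x)) x u v.

Definition tn_bar (x : pt) : 'M[R]_n.+1 := \matrix_(i, j) bar_form x (ec i) (ec j).

Lemma bil_tn_bar x u v : bil (tn_bar x) u v = bar_form x u v.
Proof.
rewrite /bil mxE -[RHS](@sum_linear _ _ (fun w => bar_form x u w)); last first.
  by move=> *; rewrite /bar_form mformC mform_linear !(mformC _ _ _ _ u); ring.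
apply: eq_bigr => j _; rewrite [v^T _ _]mxE mulrC; congr (_ * _).
rewrite mxE -[RHS](@sum_linear _ _ (fun w => bar_form x w (ec j))); last first.
  by move=> *; rewrite /bar_form mform_linear; ring.
by apply: eq_bigr => i _; rewrite mxE.
Qed.

Lemma defining_tn : defining_fn tn_defining.
Proof.
have dx p : differentiable tn_defining p.
  by apply: differentiableB => //; exact: differentiable_sqnorm.
split; [|split] => [p bp|p _|p sp].
- by rewrite /tn_defining subr_gt0.
- exact: dx.
split; first by rewrite /tn_defining sp subrr.
(* In the radial direction the derivative is -2. *)
exists p; rewrite -deriveE//.
have h : is_derive p p tn_defining (0 + - (2 * edot p p)).
  exact: is_derive_add (is_derive_const _ _ _) (is_derive_opp (is_derive_sqnorm p p)).
have [_ ->] := h; rewrite sp mulr1 add0r oppr_eq0.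
by rewrite pnatr_eq0.
Qed.

Lemma tn_barE x : ball1 x -> tn_bar x = tn_defining x ^+ 2 *: g x.
Proof.
move=> bx; apply/matrixP => i j; rewrite !mxE gformE /bar_form /gcoef1 /conf /tn_defining.
have x1 : 1 - edot x x != 0 by rewrite subr_eq0 eq_sym ball1_neq1.
by field; rewrite x1 gt_eqF.
Qed.

Lemma continuous_tn_bar : {within (@cball1 R n), continuous tn_bar}.
Proof.
apply/subspace_continuousP => p bp; apply: cvg_mx => i j; rewrite mxE.
under eq_fun do rewrite mxE.
have p1 : 0 <= edot p p <= 1 by rewrite edot_ge0.
have e0 : pre P (edot p p) != 0 by rewrite gt_eqF// (tn_pre_gt0 k_gt0 lam_gt0).
have ap : (fun x : pt => x) @ within (@cball1 R n) (nbhs p) --> p by exact: cvg_within.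
have aa : (fun x : pt => edot x x) @ within (@cball1 R n) (nbhs p) --> edot p p
  by exact: cvg_edot.
have ae u : (fun x : pt => edot x u) @ within (@cball1 R n) (nbhs p) --> edot p u.
  by apply: cvg_edot => //; exact: cvg_cst.
have Je u : (fun x : pt => edot (J x) u) @ within (@cball1 R n) (nbhs p) --> edot (J p) u.
  by apply: cvg_edot; [exact: cvg_Jrot|exact: cvg_cst].
have dd : (fun x : pt => pr P (edot x x)) @ within (@cball1 R n) (nbhs p) --> pr P (edot p p).
  apply: (@cvg_comp _ _ _ (fun x : pt => edot x x) (pr P) _ (nbhs (edot p p))).
    exact: aa.
  exact: continuous_horner.
have ee : (fun x : pt => (pre P (edot x x))^-1) @ within (@cball1 R n) (nbhs p)
    --> (pre P (edot p p))^-1.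
  apply: cvgV => //; rewrite /pre; apply: cvgB; first exact: cvg_cst.
  exact: (cvgM aa dd).
rewrite /bar_form /mform; apply: cvgM; first exact: cvg_cst.
apply: cvgD; first apply: cvgD.
- exact: cvg_cst.
- exact: (cvgM (cvgM dd ee) (cvgM (ae _) (ae _))).
- exact: (cvgM (cvgN dd) (cvgM (Je _) (Je _))).
Qed.

Lemma profile1 : (profile k).[1] = 4^-1 :> R.
Proof.
have K1 : 1 <= K by rewrite ler1n.
have := profile_ode k (1 : R); rewrite expr1n subrr mulr0 mul0r add0r !mulr1 => h.
have m0 : K + 2 + 2 * K + K != 0 by rewrite gt_eqF//; lra.
by apply: (mulfI m0); rewrite h; field.
Qed.

(** On the sphere [pr = tau] because b(1) is [1 / 4], and the radial term dies on tangent vectors.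
    Since [tau = 1 - 1 / lam], pulling out one more factor [1 / lam] leaves the Berger form. *)
Lemma tn_bar_sphere p u v : sphere1 p -> edot u p = 0 -> edot v p = 0 ->
  bil (tn_bar p) u v = 4 / lam ^+ 2 * berger lam p u v.
Proof.
move=> sp up vp; rewrite bil_tn_bar /bar_form /mform sp.
rewrite (edotC p u) (edotC p v) up vp pr_tn profile1 /tn_tau /berger.
by rewrite !mulr0; field; rewrite gt_eqF.
Qed.

Lemma tn_CCE : CCE_with_infinity g lam.
Proof.
have n_odd : odd n by rewrite nE oddD mul2n odd_double.
have c_gt0 : 0 < c by rewrite invr_gt0.
have pre_gt0 := tn_pre_gt0 k_gt0 lam_gt0.
have nR : n%:R = 2 * K + 1 :> R by rewrite nE natrD natrM.
(* As [lam * pre] lies between the minimum and the maximum of 1 and [lam], this quotient bounds both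
   [pre] and [1 / pre] from below. *)
pose mu : R := Num.min 1 lam / Num.max 1 lam.
have mn0 : 0 < Num.min 1 lam by rewrite lt_min ltr01.
have mx0 : 0 < Num.max 1 lam by rewrite lt_max ltr01.
split.
- exact: (riem_metric_tn n_odd c_gt0 pre_gt0).
- apply: (@complete_tn_metric _ _ c P n_odd c_gt0 pre_gt0 mu).
  + exact: divr_gt0.
  + by rewrite ler_pdivrMr// mul1r ge_min le_max lexx.
  move=> t t01; have /andP[h1 h2] := tn_pre_bounds k_gt0 lam_gt0 t01; split.
  + rewrite -(ler_pM2l lam_gt0); apply: le_trans h1.
    by rewrite /mu mulrCA ger_pMr// ler_pdivrMr// mul1r le_max lexx orbT.
  + rewrite -(ler_pM2l lam_gt0) mulr1 mulrCA.
    apply: (@le_trans _ _ (mu * Num.max 1 lam)); first by rewrite ler_wpM2l// ltW// divr_gt0.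
    by rewrite /mu divfK ?gt_eqF// ge_min lexx orbT.
- apply: (@einstein_tn_metric _ _ c P n_odd c_gt0 pre_gt0 K (tn_tau lam)) => //.
  + by rewrite /tn_tau; ring.
  + exact: tn_ode.
  + exact: tn_dode.
exists tn_defining, tn_bar, (fun=> 4 / lam ^+ 2); split.
- exact: defining_tn.
- exact: continuous_tn_bar.
- by move=> p; exact: tn_barE.
move=> p sp; split; first by rewrite divr_gt0// exprn_gt0.
by move=> u v up vp; exact: tn_bar_sphere.
Qed.

End ConformalBoundary.

(** The solution of [(lam - 1) * weyl_max k = 1]. It is 2 for [k = 1] and decreases towards
    [4 / 3]. *)
Definition tn_threshold {R : realType} (k : nat) : R := 1 + (k%:R + 2) / (3 * k%:R).

Section Threshold.
Context {R : realType} {n k : nat}.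
Hypothesis k_gt0 : (0 < k)%N.
Hypothesis n_odd : odd n.
Local Notation K := (k%:R : R).
Local Notation metric lam := (@tn_metric R n lam^-1 (tn_poly k lam)).

Lemma tn_threshold_bounds : 1 < (tn_threshold k : R) <= 2.
Proof.
have K1 : 1 <= K by rewrite ler1n.
rewrite /tn_threshold ltrDl divr_gt0/=; [|lra|lra].
suff : (K + 2) / (3 * K) <= 1 by lra.
by rewrite ler_pdivrMr; lra.
Qed.

Lemma weyl_max_threshold (lam : R) : lam <= tn_threshold k -> (lam - 1) * weyl_max k <= 1.
Proof.
have K1 : 1 <= K by rewrite ler1n.
have w0 : 0 < weyl_max k :> R by rewrite divr_gt0//; lra.
move=> h; have wE : (tn_threshold k - 1) * weyl_max k = 1 :> R.
  by rewrite /tn_threshold /weyl_max; field; rewrite !gt_eqF//; lra.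
by rewrite -[leRHS]wE; apply: ler_wpM2r; [exact: ltW|lra].
Qed.

Lemma sec_center_threshold (lam : R) : 0 < lam ->
  sec (metric lam) 0 (ecoord R 0) (Jrot (ecoord R 0)) =
  3 * K / (K + 2) * (lam - tn_threshold k).
Proof.
move=> l0; have K1 : 1 <= K by rewrite ler1n.
rewrite sec_center//; last by rewrite edot_ecoordr mxE !eqxx.
by rewrite /tn_tau /tn_threshold; field; rewrite !gt_eqF//; lra.
Qed.

End Threshold.

Unset Implicit Arguments.

Theorem theorem1p4 (R : realType) (k n : nat) (hk : (1 <= k)%N)
  (hn : n = (2 * k + 1)%N) :
  (* lower branch: lambda in (1/(n+1), 1] *)
  ((forall lam : R, (n.+1%:R)^-1 < lam <= 1 ->
      exists g : 'rV[R]_n.+1 -> 'M[R]_n.+1, CCE_with_infinity g lam /\ nonpos_curved g)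
   \/
   (exists lam1 : R, (n.+1%:R)^-1 < lam1 <= 1 /\
      exists G : R -> 'rV[R]_n.+1 -> 'M[R]_n.+1,
        (forall lam, lam1 <= lam <= 1 ->
           CCE_with_infinity (G lam) lam /\ nonpos_curved (G lam)) /\
        sec_vanishes_somewhere (G lam1) /\
        exists e0 : R, 0 < e0 /\ forall e : R, 0 < e < e0 ->
          exists lam2 : R, lam1 - e < lam2 < lam1 /\
            exists g : 'rV[R]_n.+1 -> 'M[R]_n.+1, CCE_with_infinity g lam2 /\ sec_positive_somewhere g))
  /\
  (* upper branch: lambda in [1, n+1) *)
  ((forall lam : R, 1 <= lam < n.+1%:R ->
      exists g : 'rV[R]_n.+1 -> 'M[R]_n.+1, CCE_with_infinity g lam /\ nonpos_curved g)
   \/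
   (exists lam1 : R, 1 <= lam1 < n.+1%:R /\
      exists G : R -> 'rV[R]_n.+1 -> 'M[R]_n.+1,
        (forall lam, 1 <= lam <= lam1 ->
           CCE_with_infinity (G lam) lam /\ nonpos_curved (G lam)) /\
        sec_vanishes_somewhere (G lam1) /\
        exists e0 : R, 0 < e0 /\ forall e : R, 0 < e < e0 ->
          exists lam2 : R, lam1 < lam2 < lam1 + e /\
            exists g : 'rV[R]_n.+1 -> 'M[R]_n.+1, CCE_with_infinity g lam2 /\ sec_positive_somewhere g)).
Proof.
have k_gt0 : (0 < k)%N := hk.
have n_odd : odd n by rewrite hn oddD mul2n odd_double.
have /andP[th1 th2] := @tn_threshold_bounds R k k_gt0.
pose g (lam : R) := @tn_metric R n lam^-1 (tn_poly k lam).
have gP (lam : R) : 0 < lam -> CCE_with_infinity (g lam) lam.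
  by move=> l0; exact: (tn_CCE k_gt0 hn l0).
have gN (lam : R) : 0 < lam -> lam <= tn_threshold k -> nonpos_curved (g lam).
  by move=> l0 lt; apply: nonpos_curved_tn => //; exact: weyl_max_threshold.
have X1 : edot (ecoord R (0 : 'I_n.+1)) (ecoord R 0) = 1.
  by rewrite edot_ecoordr mxE !eqxx.
have b0 : ball1 (0 : 'rV[R]_n.+1) by rewrite /ball1 /= edot0l ltr01.
have K0 : 0 < 3 * k%:R / (k%:R + 2) :> R.
  by rewrite divr_gt0// ?mulr_gt0 ?ltr0n// ltr_wpDl.
split; [left|right].
  move=> lam /andP[l1 l2]; exists (g lam).
  have l0 : 0 < lam by apply: lt_trans l1; rewrite invr_gt0 ltr0n.
  by split; [exact: gP|apply: gN => //; lra].
exists (tn_threshold k); split.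
  (* The threshold is at most 2, while [n + 1 = 2 k + 2] is at least 4. *)
  rewrite ltW//=; apply: (le_lt_trans th2).
  by rewrite ltr_nat hn; lia.
exists g; split; [|split].
- move=> lam /andP[l1 l2]; have l0 : 0 < lam by lra.
  by split; [exact: gP|exact: gN].
- exists 0, (ecoord R 0), (Jrot (ecoord R 0)); split=> //; first exact: indep2_Jrot.
  by rewrite sec_center_threshold ?subrr ?mulr0//; lra.
(* The choice 1 is arbitrary: for every [lam] above the threshold the complex line at the center
   already has positive curvature. *)
exists 1; split=> // e /andP[e0 _].
exists (tn_threshold k + e / 2); split; first by apply/andP; split; lra.
exists (g (tn_threshold k + e / 2)); split; first by apply: gP; lra.
exists 0, (ecoord R 0), (Jrot (ecoord R 0)); split=> //; first exact: indep2_Jrot.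
rewrite sec_center_threshold//; last by lra.
by apply: mulr_gt0 => //; lra.
Qed.
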